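(* For $f\in\mathcal A$ the following are equivalent: (1) $f\in\mathcal J$; (2) $f$ has zero sums at every $v\in\mathrm{Cu}_2\setminus\{\lozenge\}$ without symmetric core; (3) there are no $g,h\in\mathcal A$ with $g\#f\#h=\delta_e$. In particular $\mathcal J=\{f\in\mathcal A:\text{there are no }g,h\in\mathcal A\text{ with }g\#f\#h=\delta_e\}$, and $\mathcal J$ is the unique maximal two-sided ideal of $\mathcal A$.
   Context: Let $\mathrm{Cu}_2$ be the involutive monoid with identity $e$ and zero element $\lozenge$ (so $\lozenge t=\lozenge=t\lozenge$ for all $t$), generated by $s_1,s_2,s_1^*,s_2^*$ subject to $s_1^*s_1=e=s_2^*s_2$ and $s_1^*s_2=\lozenge=s_2^*s_1$, with involution $t\mapsto t^*$ satisfying $(t^* )^*=t$, $(tu)^*=u^*t^*$. Let $\mathbf I_0=\{\emptyset\}$, $\mathbf I_n=\{1,2\}^n$, $\mathbf I=\bigcup_{n\ge0}\mathbf I_n$ (finite words; concatenation written $\mathbf{ij}$), and $\mathbf L=\{1,2\}^{\mathbb N}$; for $\mathbf n=(n_1,n_2,\dots)\in\mathbf L$ put $\mathbf n_0=\emptyset$, $\mathbf n_l=(n_1,\dots,n_l)$. For $\mathbf i=(i_1,\dots,i_k)\in\mathbf I$ put $s_{\mathbf i}=s_{i_1}\cdots s_{i_k}$ ($s_\emptyset=e$) and $s_{\mathbf i}^*=(s_{\mathbf i})^*$. Every $t\in\mathrm{Cu}_2\setminus\{\lozenge\}$ can be written uniquely as $t=s_{\mathbf i}s_{\mathbf j}^*$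 with $\mathbf i,\mathbf j\in\mathbf I$. Let $\mathcal A=\ell^1(\mathrm{Cu}_2\setminus\{\lozenge\})$ with product $\#$ determined by bilinearity and continuity from $\delta_s\#\delta_t=\delta_{st}$ if $st\neq\lozenge$ and $\delta_s\#\delta_t=0$ if $st=\lozenge$; this is a unital Banach $*$-algebra with unit $\delta_e$. Let $f_0=\delta_e-\delta_{s_1s_1^*}-\delta_{s_2s_2^*}$ and let $\mathcal J$ be the closed two-sided ideal of $\mathcal A$ generated by $f_0$. An element $f\in\mathcal A$ has zero sums at $v=s_{\mathbf i}s_{\mathbf j}^*$ if $\sum_{l=0}^\infty f(s_{\mathbf i\mathbf n_l}s_{\mathbf j\mathbf n_l}^* )=0$ for every $\mathbf n\in\mathbf L$. An element $t\in\mathrm{Cu}_2\setminus\{\lozenge\}$ is without symmetric core if whenever $t=s_{\mathbf{mk}}s_{\mathbf{nk}}^*$ with $\mathbf m,\mathbf n,\mathbf k\in\mathbf I$ then $\mathbf k=\emptyset$. *)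

(* Defs.v *)
From mathcomp Require Import all_boot all_order all_algebra.
From mathcomp Require Import reals.
From mathcomp Require Import complex.

Set Implicit Arguments.
Unset Strict Implicit.
Unset Printing Implicit Defensive.

Import Order.TTheory GRing.Theory Num.Theory.
Local Open Scope ring_scope.

(* Finite words over {1,2}; letter 1 is encoded by false, letter 2 by true. *)
Definition word := seq bool.

(* Nonzero elements of Cu_2, via the unique normal form s_i s_j^* = (i, j). *)
Definition cu := (word * word)%type.

(* Product in Cu_2; None stands for the zero element (lozenge).
   (s_i s_j^* )(s_k s_l^* ) = s_{i k'} s_l^*   if k = j k',
                             = s_i s_{l j'}^*  if j = k j',
                             = lozenge         otherwise. *)
Definition cu_mul (p q : cu) : option cu :=
  let: (i, j) := p in let: (k, l) := q in
  if prefix j k then Some (i ++ drop (size j) k, l)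
  else if prefix k j then Some (i, l ++ drop (size k) j)
  else None.

Definition cu_e : cu := ([::], [::]).

Section L1.
Variable R : realType.
Local Notation C := (R[i]).

Definition series_to (a : nat -> C) (l : C) : Prop :=
  forall eps : C, 0 < eps -> exists N : nat, forall n : nat, (N <= n)%N ->
    `| \sum_(k < n) a k - l | < eps.

(* enumeration of a countable type (each element exactly once) *)
Definition enum_at (T : countType) (a : T -> C) (n : nat) : C :=
  oapp a 0 (@pickle_inv T n).

Definition abs_summable (T : countType) (a : T -> C) : Prop :=
  exists M : C, forall n : nat, \sum_(k < n) `| enum_at a k | <= M.

(* sum of a family over a countable type (unconditional for abs. summable) *)
Definition sum_to (T : countType) (a : T -> C) (l : C) : Prop :=
  series_to (enum_at a) l.

Definition inA (f : cu -> C) : Prop := abs_summable f.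

Definition norm1_le (f : cu -> C) (eps : C) : Prop :=
  forall n : nat, \sum_(k < n) `| enum_at f k | <= eps.

(* the convolution product f # g = h (as a relation; for f, g in A the
   product exists and is unique) *)
Definition conv (f g h : cu -> C) : Prop :=
  forall t : cu,
    sum_to (fun pq : cu * cu =>
              if cu_mul pq.1 pq.2 == Some t then f pq.1 * g pq.2 else 0)
           (h t).

Definition delta (s : cu) : cu -> C := fun t => (t == s)%:R.

Definition delta_e : cu -> C := delta cu_e.

Definition f0 : cu -> C := fun t =>
  delta_e t - delta ([:: false], [:: false]) t - delta ([:: true], [:: true]) t.

Definition is_ideal (I : (cu -> C) -> Prop) : Prop :=
  (forall f, I f -> inA f) /\
  [/\ I (fun _ => 0),
      forall f g, I f -> I g -> I (fun t => f t + g t),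
      forall (c : C) f, I f -> I (fun t => c * f t),
      forall a f h, inA a -> I f -> conv a f h -> I h &
      forall a f h, inA a -> I f -> conv f a h -> I h].

Definition is_closed (I : (cu -> C) -> Prop) : Prop :=
  forall (u : nat -> cu -> C) (f : cu -> C),
    (forall n, I (u n)) -> inA f ->
    (forall eps : C, 0 < eps -> exists N : nat, forall n : nat, (N <= n)%N ->
        norm1_le (fun t => u n t - f t) eps) ->
    I f.

Definition inJ (f : cu -> C) : Prop :=
  forall I, is_ideal I -> is_closed I -> I f0 -> I f.

Definition zero_sums_at (f : cu -> C) (v : cu) : Prop :=
  forall n : nat -> bool,
    series_to (fun l => f (v.1 ++ mkseq n l, v.2 ++ mkseq n l)) 0.

Definition without_symmetric_core (v : cu) : Prop :=
  forall m n k : word, v = (m ++ k, n ++ k) -> k = [::].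

Definition two_sided_invertible (f : cu -> C) : Prop :=
  exists g h gf, [/\ inA g, inA h, conv g f gf & conv gf h delta_e].

Definition proper_ideal (I : (cu -> C) -> Prop) : Prop :=
  is_ideal I /\ exists f, inA f /\ ~ I f.

Definition maximal_ideal (I : (cu -> C) -> Prop) : Prop :=
  proper_ideal I /\
  forall K, proper_ideal K -> (forall f, I f -> K f) -> forall f, K f -> I f.

End L1.

(* Main.v *)
(* For infinite words [y], [x] and a lag [k], let T(y,k,x) be the set of the
   [s_i s_j^*] with [y = i z], [x = j z] and [|i| - |j| = k].  The zero-sum condition
   at core-free elements says that [f] sums to zero over every T(y,k,x).
   For a fixed [s], the set of [q] with [s q] in T(y,k,x) is empty or again of this
   form, so the zero-sum functions form a closed ideal; it contains [f0].
   Conversely, let [F p] be the sum of [f] over the elements obtained from [p] by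
   stripping a common suffix.  Truncating the formal expansion
   [f = sum_p F p (delta_p - delta_(p1) - delta_(p2))] to words of length at most [N]
   gives an element of the ideal generated by [f0]; the error lives outside the box,
   and since [f] has zero sums, [F p] on its boundary is minus the sum of [f] along a
   path leaving the box, so the error tends to 0 in norm.
   If the sum over some T(y,k,x) is not zero, compress [f] between long prefixes of
   [y] and [x] followed by one aperiodic word: up to a small error the compression is
   a nonzero multiple of [delta_e], and a Neumann series inverts it. *)
Require Import Defs.
From mathcomp Require Import all_boot all_order all_algebra.
From mathcomp Require Import reals.
From mathcomp Require Import complex.
From mathcomp Require Import boolp classical_sets zify.

Set Implicit Arguments.
Unset Strict Implicit.
Unset Printing Implicit Defensive.

Import Order.TTheory GRing.Theory Num.Theory.
Local Open Scope ring_scope.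

(** * Unconditional sums of complex families *)

Section Sums.
Variable R : realType.
Local Notation C := (R[i]).
Implicit Types (T U : eqType).

Definition bounded_by T (a : T -> C) (M : C) : Prop :=
  forall s : seq T, uniq s -> \sum_(x <- s) `|a x| <= M.

(** Convergence along the net of finite subsets. Since no enumeration enters, reindexing and Fubini
    take their natural form. *)
Definition has_sum T (a : T -> C) (l : C) : Prop :=
  forall eps : C, 0 < eps -> exists s : seq T, forall s' : seq T,
    uniq s' -> {subset s <= s'} -> `|\sum_(x <- s') a x - l| < eps.

Definition summable T (a : T -> C) : Prop := exists M, bounded_by a M.

(** The value defaults to 0 when the family has no sum. *)
Definition usum T (a : T -> C) : C := xget 0 [set l | has_sum a l].

Lemma divr2_gt0 (e : C) : 0 < e -> 0 < e / 2.
Proof. by move=> e0; rewrite divr_gt0 // ltr0n. Qed.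

Lemma norm_small0 (x : C) : (forall e : C, 0 < e -> `|x| <= e) -> x = 0.
Proof.
move=> h; apply/eqP/negPn/negP => x0.
have x0' : 0 < `|x| by rewrite normr_gt0.
have := h _ (divr2_gt0 x0').
by rewrite {1}(splitr `|x|) gerDl => /(lt_le_trans (divr2_gt0 x0')); rewrite ltxx.
Qed.

(** The order on [C] is partial; [0 <= M] makes [M] real and hence comparable with [|x|]. *)
Lemma norm_le_eps (x M : C) : 0 <= M ->
  (forall e : C, 0 < e -> `|x| <= M + e) -> `|x| <= M.
Proof.
move=> M0 h; case: (@real_leP C `|x| M); rewrite ?ger0_real // => Mx.
have d0 : 0 < `|x| - M by rewrite subr_gt0.
have := h _ (divr2_gt0 d0).
rewrite -lerBlDl {1}(splitr (`|x| - M)) gerDl.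
by move/(lt_le_trans (divr2_gt0 d0)); rewrite ltxx.
Qed.

Lemma bounded_by_ge0 T (a : T -> C) M : bounded_by a M -> 0 <= M.
Proof. by move=> /(_ [::] isT); rewrite big_nil. Qed.

Lemma bounded_by_le T (a b : T -> C) M :
  (forall x, `|a x| <= `|b x|) -> bounded_by b M -> bounded_by a M.
Proof. by move=> ab hb s us; apply: le_trans (hb s us); apply: ler_sum. Qed.

Lemma bounded_by_trans T (a : T -> C) M N :
  M <= N -> bounded_by a M -> bounded_by a N.
Proof. by move=> MN h s us; apply: le_trans MN; apply: h. Qed.

Lemma bounded_by0 T : bounded_by (fun _ : T => 0 : C) 0.
Proof. by move=> s _; rewrite big1 // => x _; rewrite normr0. Qed.

Lemma bounded_byD T (a b : T -> C) M N :
  bounded_by a M -> bounded_by b N -> bounded_by (fun x => a x + b x) (M + N).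
Proof.
move=> ha hb s us; apply: le_trans (lerD (ha s us) (hb s us)).
by rewrite -big_split; apply: ler_sum => x _; apply: ler_normD.
Qed.

Lemma bounded_byZ T (c : C) (a : T -> C) M :
  bounded_by a M -> bounded_by (fun x => c * a x) (`|c| * M).
Proof.
move=> ha s us; under eq_bigr do rewrite normrM.
by rewrite -mulr_sumr ler_wpM2l ?normr_ge0 ?ha.
Qed.

(** Injectivity is asked only on the support of [a], so a family padded with zeros can be bounded
    through a map that is not injective elsewhere. *)
Lemma bounded_by_inj T U (h : T -> U) (a : T -> C) (b : U -> C) M :
  (forall x y, a x != 0 -> a y != 0 -> h x = h y -> x = y) ->
  (forall x, `|a x| <= `|b (h x)|) ->
  bounded_by b M -> bounded_by a M.
Proof.
move=> hinj hab hb s us.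
rewrite (bigID (fun x => a x == 0)) /= big1 ?add0r; last first.
  by move=> x /eqP ->; rewrite normr0.
rewrite -big_filter.
have ht : uniq (map h [seq x <- s | a x != 0]).
  rewrite map_inj_in_uniq ?filter_uniq // => x y.
  by rewrite !mem_filter => /andP[ax _] /andP[ay _]; apply: hinj.
by apply: le_trans (hb _ ht); rewrite big_map; apply: ler_sum.
Qed.

Lemma bounded_by_single T (a : T -> C) x0 :
  (forall x, x != x0 -> a x = 0) -> bounded_by a `|a x0|.
Proof.
move=> h s us; case: (boolP (x0 \in s)) => hx.
  rewrite (bigD1_seq x0) //= big1 ?addr0 // => x /h ->; exact: normr0.
rewrite big_seq big1 // => x xs; rewrite h ?normr0 //.
by apply: contraNneq hx => <-.
Qed.

(** Group a finite set of pairs by first coordinate; the group over [t] is bounded by [m t]. *)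
Lemma bounded_by_prod T U (a : T * U -> C) (m : T -> C) M :
  (forall t, bounded_by (fun u => a (t, u)) (m t)) -> bounded_by m M ->
  bounded_by a M.
Proof.
move=> hrow hm s us; pose V := undup (map fst s).
apply: le_trans (hm V (undup_uniq _)).
have -> : \sum_(x <- s) `|a x| =
    \sum_(t <- V) \sum_(x <- s | x.1 == t) `|a x|.
  rewrite (exchange_big_dep predT) //= big_seq [RHS]big_seq.
  apply: eq_bigr => x xs.
  rewrite -big_filter (_ : [seq i <- V | x.1 == i] = [:: x.1]) ?big_seq1 //.
  apply: perm_small_eq => //; apply: uniq_perm => //.
    by rewrite filter_uniq ?undup_uniq.
  move=> t; rewrite mem_filter inE eq_sym andb_idr // => /eqP ->.
  by rewrite mem_undup map_f.
apply: ler_sum => t _; rewrite -big_filter.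
have ut : uniq (map snd [seq x <- s | x.1 == t]).
  rewrite map_inj_in_uniq ?filter_uniq // => -[x1 x2] [y1 y2].
  by rewrite !mem_filter /= => /andP[/eqP -> _] /andP[/eqP -> _] ->.
rewrite ger0_norm ?(bounded_by_ge0 (hrow t)) //.
apply: le_trans (hrow t _ ut); rewrite big_map big_seq [leRHS]big_seq.
apply: ler_sum => -[x1 x2]; rewrite mem_filter /= => /andP[/eqP -> _] //.
Qed.

Lemma has_sum_unique T (a : T -> C) l l' : has_sum a l -> has_sum a l' -> l = l'.
Proof.
move=> h h'; apply/eqP; rewrite -subr_eq0; apply/eqP/norm_small0 => e e0.
have [s hs] := h _ (divr2_gt0 e0); have [s' hs'] := h' _ (divr2_gt0 e0).
pose v := undup (s ++ s').
have sv : {subset s <= v} by move=> x xs; rewrite mem_undup mem_cat xs.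
have s'v : {subset s' <= v} by move=> x xs; rewrite mem_undup mem_cat xs orbT.
have {hs} h1 := ltW (hs v (undup_uniq _) sv).
have {hs'} h2 := ltW (hs' v (undup_uniq _) s'v).
apply: le_trans (ler_distD (\sum_(x <- v) a x) _ _) _.
by rewrite distrC (splitr e) lerD.
Qed.

Lemma sumE T (a : T -> C) l : has_sum a l -> usum a = l.
Proof.
move=> h; apply: has_sum_unique (h).
by apply: (xgetPex 0 (P := [set l | has_sum a l])); exists l.
Qed.

Lemma has_sumD T (a b : T -> C) l l' : has_sum a l -> has_sum b l' ->
  has_sum (fun x => a x + b x) (l + l').
Proof.
move=> h h' e e0.
have [s hs] := h _ (divr2_gt0 e0); have [s' hs'] := h' _ (divr2_gt0 e0).
exists (s ++ s') => v uv sv.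
have h1 : `|\sum_(x <- v) a x - l| < e / 2.
  by apply: hs => // x xs; apply: sv; rewrite mem_cat xs.
have h2 : `|\sum_(x <- v) b x - l'| < e / 2.
  by apply: hs' => // x xs; apply: sv; rewrite mem_cat xs orbT.
rewrite big_split opprD addrACA (splitr e).
exact: le_lt_trans (ler_normD _ _) (ltrD h1 h2).
Qed.

Lemma has_sumZ T (c : C) (a : T -> C) l : has_sum a l ->
  has_sum (fun x => c * a x) (c * l).
Proof.
have [->|c0] := eqVneq c 0.
  move=> _ e e0; exists [::] => s _ _.
  by rewrite mul0r subr0 big1 ?normr0 // => x _; rewrite mul0r.
have c0' : 0 < `|c| by rewrite normr_gt0.
move=> h e e0; have [s hs] := h _ (divr_gt0 e0 c0').
exists s => v uv sv; rewrite -mulr_sumr -mulrBr normrM mulrC -ltr_pdivlMr //.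
exact: hs.
Qed.

Lemma has_sum_single T (a : T -> C) x0 :
  (forall x, x != x0 -> a x = 0) -> has_sum a (a x0).
Proof.
move=> h e e0; exists [:: x0] => s us /(_ x0); rewrite mem_head => /(_ isT) xs.
by rewrite (bigD1_seq x0) //= big1 // addr0 subrr normr0.
Qed.

Lemma has_sum0 T : has_sum (fun _ : T => 0 : C) 0.
Proof. by move=> e e0; exists [::] => s _ _; rewrite big1 // subrr normr0. Qed.

Lemma has_sum_norm_le T (a : T -> C) l M :
  bounded_by a M -> has_sum a l -> `|l| <= M.
Proof.
move=> ha h; apply: norm_le_eps (bounded_by_ge0 ha) _ => e e0.
have [s hs] := h _ e0.
have sv : {subset s <= undup s} by move=> x; rewrite mem_undup.
have {}hs := ltW (hs _ (undup_uniq s) sv).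
rewrite -[l](subKr (\sum_(x <- undup s) a x)).
apply: le_trans (ler_normB _ _) _; rewrite lerD //.
exact: le_trans (ler_norm_sum _ _ _) (ha _ (undup_uniq s)).
Qed.

Lemma has_sum_bij T U (h : T -> U) (g : U -> T) (a : U -> C) l :
  cancel h g -> cancel g h -> has_sum a l -> has_sum (a \o h) l.
Proof.
move=> hg gh ha e e0; have [s hs] := ha e e0; exists (map g s) => v uv sv.
rewrite -(big_map h predT a); apply: hs; first by rewrite map_inj_uniq //; apply: can_inj hg.
by move=> x xs; rewrite -[x]gh map_f // sv // map_f.
Qed.

(** The sum is the supremum of the finite partial sums, which increase with the finite set. *)
Lemma has_sum_nneg T (a : T -> R) M : (forall x, 0 <= a x) ->
  bounded_by (fun x => (a x)%:C%C) M -> exists l, has_sum (fun x => (a x)%:C%C) l.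
Proof.
move=> a0 hM.
pose E := [set r : R | exists2 s : seq T, uniq s & r = \sum_(x <- s) a x]%classic.
have M0 := bounded_by_ge0 hM.
have EM r : E r -> r <= complex.Re M.
  move=> [s us ->]; have := hM s us.
  have -> : \sum_(x <- s) `|(a x)%:C%C| = (\sum_(x <- s) a x)%:C%C.
    rewrite (raddf_sum (real_complex R)); apply: eq_bigr => x _.
    by rewrite ger0_norm // ler0c.
  by rewrite -{1}(RRe_real (ger0_real M0)) lecR.
have hE : has_sup E.
  by split; [exists 0; exists [::] => //; rewrite big_nil | exists (complex.Re M) => r /EM].
exists (sup E)%:C%C => e e0.
have e0' : 0 < complex.Re e by move: e0; rewrite ltcE => /andP[].
have eE : (complex.Re e)%:C%C = e by rewrite RRe_real // gtr0_real.
have [r [s us ->] hr] := sup_adherent e0' hE.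
exists s => v uv sv.
rewrite -(raddf_sum (real_complex R)) -(rmorphB (real_complex R)) /=.
have h1 : \sum_(x <- v) a x <= sup E by apply: sup_upper_bound => //; exists v.
have h2 : \sum_(x <- s) a x <= \sum_(x <- v) a x.
  rewrite [leRHS](bigID (mem s)) /= -[leLHS]addr0 lerD ?sumr_ge0 //.
  have hp : perm_eq s [seq i <- v | i \in s].
    apply: uniq_perm; rewrite ?filter_uniq // => x.
    by rewrite mem_filter andb_idr // => /sv.
  by rewrite (perm_big _ hp) big_filter.
rewrite -eE -normrN -rmorphN opprB ger0_norm ?ler0c ?subr_ge0 // ltcR.
by rewrite ltrBlDl -ltrBlDr; apply: lt_le_trans hr h2.
Qed.

Lemma normc_ge_Re (z : C) : (`|complex.Re z|)%:C%C <= `|z|.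
Proof.
rewrite normc_def lecR -sqrtr_sqr ler_wsqrtr // lerDl; exact: sqr_ge0.
Qed.

Lemma normc_ge_Im (z : C) : (`|complex.Im z|)%:C%C <= `|z|.
Proof.
rewrite normc_def lecR -sqrtr_sqr ler_wsqrtr // lerDr; exact: sqr_ge0.
Qed.

Lemma bounded_has_sum T (a : T -> C) M : bounded_by a M -> exists l, has_sum a l.
Proof.
move=> hM.
have real_part (b : T -> R) :
    (forall x, (`|b x|)%:C%C <= `|a x|) -> exists l, has_sum (fun x => (b x)%:C%C) l.
  move=> hb.
  have hb' (c : T -> R) : (forall x, 0 <= c x <= `|b x|) ->
      exists l, has_sum (fun x => (c x)%:C%C) l.
    move=> hc; apply: (@has_sum_nneg _ _ M) => [x|]; first by case/andP: (hc x).
    apply: bounded_by_le hM => x; apply: le_trans (hb x).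
    by case/andP: (hc x) => c0 cb; rewrite ger0_norm ?ler0c // lecR.
  (* The positive part of [b]; the negative part follows. *)
  have [|l1 h1] := hb' (fun x => (`|b x| + b x) / 2).
  - move=> x; apply/andP; split.
      by rewrite divr_ge0 // -lerBlDr sub0r -normrN ler_norm.
    by rewrite ler_pdivrMr ?ltr0n // mulr_natr mulr2n lerD2l ler_norm.
  have [|l2 h2] := hb' (fun x => (`|b x| - b x) / 2).
  - move=> x; apply/andP; split; first by rewrite divr_ge0 // subr_ge0 ler_norm.
    by rewrite ler_pdivrMr ?ltr0n // mulr_natr mulr2n lerD2l -normrN ler_norm.
  exists (l1 + (-1) * l2); have := has_sumD h1 (has_sumZ (-1) h2).
  congr has_sum; apply/funext => x.
  rewrite mulN1r -(rmorphB (real_complex R)) /= -mulrBl opprB addrC addrA subrK.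
  by rewrite -mulr2n -[b x *+ 2]mulr_natr mulfK // pnatr_eq0.
have [l1 h1] := real_part (fun x => complex.Re (a x)) (fun x => normc_ge_Re (a x)).
have [l2 h2] := real_part (fun x => complex.Im (a x)) (fun x => normc_ge_Im (a x)).
exists (l1 + 'i%C * l2); have := has_sumD h1 (has_sumZ 'i%C h2).
by congr has_sum; apply/funext => x; rewrite -complexE.
Qed.

Lemma has_sum_sum T (a : T -> C) : summable a -> has_sum a (usum a).
Proof. by move=> [M /bounded_has_sum[l hl]]; rewrite (sumE hl). Qed.

(** Finitely many rows are each truncated to a finite set [F t] that contains the part of [s] in
    that row, so the truncations together form a finite set of pairs on which [hs] applies. *)
Lemma has_sum_fubini T U (a : T * U -> C) (b : T -> C) l :
  has_sum a l -> (forall t, has_sum (fun u => a (t, u)) (b t)) -> has_sum b l.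
Proof.
move=> ha hb e e0; have [s hs] := ha _ (divr2_gt0 e0).
exists (map fst s) => v uv sv.
(* The rows over [v] then contribute at most [e / 2] in total; the successor covers empty [v]. *)
pose d := e / 2 / (size v).+1%:R.
have d0 : 0 < d by rewrite divr_gt0 ?divr2_gt0 ?ltr0Sn.
have /choice[F hF] : forall t, exists F : seq U, [/\ uniq F,
    forall u, (t, u) \in s -> u \in F & `|\sum_(u <- F) a (t, u) - b t| < d].
  move=> t; have [F hF] := hb t _ d0.
  exists (undup (F ++ map snd s)); split; first exact: undup_uniq.
    by move=> u us; rewrite mem_undup mem_cat (map_f snd us) orbT.
  by apply: hF; rewrite ?undup_uniq // => x xF; rewrite mem_undup mem_cat xF.
pose G := [seq (t, u) | t <- v, u <- F t].
have uG : uniq G.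
  apply: allpairs_uniq_dep => //; first by move=> t _; case: (hF t).
  by move=> [t u] [t' u'] _ _ /= [-> ->].
have sG : {subset s <= G}.
  move=> [t u] us; apply/allpairsPdep; exists t, u; split=> //.
    by apply: sv; apply: (map_f fst us).
  by case: (hF t) => _ /(_ _ us).
have h1 := hs G uG sG.
rewrite big_allpairs_dep in h1.
rewrite (splitr e); apply: le_lt_trans (ler_distD _ _ _) (ler_ltD _ h1).
rewrite -sumrB; apply: le_trans (ler_norm_sum _ _ _) _.
apply: (@le_trans _ _ (\sum_(t <- v) d)).
  by apply: ler_sum => t _; rewrite distrC ltW //; case: (hF t).
rewrite big_const_seq count_predT iter_addr_0 -[d *+ _]mulr_natr /d.
rewrite mulrAC ler_pdivrMr ?ltr0Sn // ler_wpM2l ?ltW ?divr2_gt0 //.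
by rewrite ltr_nat.
Qed.

Lemma eq_has_sum T (a b : T -> C) l : a =1 b -> has_sum a l -> has_sum b l.
Proof. by move=> /funext ->. Qed.

Lemma eq_sum T (a b : T -> C) : a =1 b -> usum a = usum b.
Proof. by move=> /funext ->. Qed.

Lemma summable_row T U (a : T * U -> C) t :
  summable a -> summable (fun u => a (t, u)).
Proof.
by move=> [M hM]; exists M; apply: (bounded_by_inj (h := pair t)) hM => // x y _ _ [].
Qed.

Lemma summable_swap T U (a : T * U -> C) :
  summable a -> summable (fun p : U * T => a (p.2, p.1)).
Proof.
move=> [M hM]; exists M.
by apply: (bounded_by_inj (h := fun p : U * T => (p.2, p.1))) hM => // -[x y] [x' y'] _ _ [-> ->].
Qed.

Lemma summable_col T U (a : T * U -> C) u :
  summable a -> summable (fun t => a (t, u)).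
Proof. by move=> /summable_swap /(summable_row u). Qed.

Lemma sum_pairl T U (a : T * U -> C) :
  summable a -> usum a = usum (fun t => usum (fun u => a (t, u))).
Proof.
move=> ha; apply/esym/sumE/(has_sum_fubini (has_sum_sum ha)) => t.
exact/has_sum_sum/summable_row.
Qed.

Lemma sum_swap T U (a : T * U -> C) : summable a ->
  usum a = usum (fun p : U * T => a (p.2, p.1)).
Proof.
move=> ha; apply/esym/sumE.
by apply: (has_sum_bij (h := fun p : U * T => (p.2, p.1)) (g := fun p => (p.2, p.1)))
  (has_sum_sum ha) => -[].
Qed.

Lemma sum_pairr T U (a : T * U -> C) :
  summable a -> usum a = usum (fun u => usum (fun t => a (t, u))).
Proof. by move=> ha; rewrite sum_swap // sum_pairl //; exact: summable_swap. Qed.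

(** Replace each of finitely many rows by a finite part of it, with small total error; the chosen
    entries form one finite set of pairs, to which [hM] applies. *)
Lemma bounded_by_rows T U (a : T * U -> C) (b : T -> C) M : bounded_by a M ->
  (forall t, has_sum (fun u => a (t, u)) (b t)) -> bounded_by b M.
Proof.
move=> hM hb v uv.
rewrite -[leLHS]ger0_norm ?sumr_ge0 //.
apply: norm_le_eps (bounded_by_ge0 hM) _ => e e0; rewrite ger0_norm ?sumr_ge0 //.
pose d := e / (size v).+1%:R.
have d0 : 0 < d by rewrite divr_gt0 ?ltr0Sn.
have /choice[F hF] : forall t, exists F : seq U, uniq F /\
    `|\sum_(u <- F) a (t, u) - b t| < d.
  move=> t; have [F hF] := hb t _ d0.
  exists (undup F); split; first exact: undup_uniq.
  by apply: hF; rewrite ?undup_uniq // => x; rewrite mem_undup.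
have uG : uniq [seq (t, u) | t <- v, u <- F t].
  apply: allpairs_uniq_dep => //; first by move=> t _; case: (hF t).
  by move=> [t u] [t' u'] _ _ /= [-> ->].
have := hM _ uG; rewrite big_allpairs_dep => h1.
apply: (@le_trans _ _ (\sum_(t <- v) (\sum_(u <- F t) `|a (t, u)| + d))).
  apply: ler_sum => t _; rewrite -[b t](subKr (\sum_(u <- F t) a (t, u))).
  apply: le_trans (ler_normB _ _) _; rewrite lerD ?ler_norm_sum // ltW //.
  by case: (hF t).
rewrite big_split lerD // big_const_seq count_predT iter_addr_0 -[d *+ _]mulr_natr /d.
by rewrite mulrAC ler_pdivrMr ?ltr0Sn // ler_wpM2l ?ltW // ltr_nat.
Qed.

(** A finite sum of norms off [s] is the difference of two partial sums containing [s], both within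
    [e / 2] of the total. *)
Lemma summable_tail T (a : T -> C) M (e : C) : bounded_by a M -> 0 < e ->
  exists2 s : seq T, uniq s & bounded_by (fun x => if x \in s then 0 else a x) e.
Proof.
move=> hM e0.
have [l hl] : exists l, has_sum (fun x => `|a x|) l.
  apply: (@bounded_has_sum _ _ M); apply: bounded_by_le hM => x.
  by rewrite normr_id.
have [s hs] := hl _ (divr2_gt0 e0); exists (undup s); first exact: undup_uniq.
have hu := undup_uniq s.
have h1 := ltW (hs (undup s) hu (fun x => etrans (mem_undup s x))).
move=> v uv; rewrite (bigID (mem (undup s))) /= big1 ?add0r; last first.
  by move=> x ->; rewrite normr0.
rewrite -big_filter; set w := filter _ _.
have uw : uniq (undup s ++ w).
  rewrite cat_uniq hu filter_uniq // andbT /=; apply/hasPn => x.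
  by rewrite mem_filter => /andP[].
have {}hs : `|\sum_(x <- undup s ++ w) `|a x| - l| < e / 2.
  by apply: hs => // x xs; rewrite mem_cat mem_undup xs.
have -> : \sum_(x <- w) `|if x \in undup s then 0 else a x| = \sum_(x <- w) `|a x|.
  apply: eq_big_seq => x; rewrite mem_filter => /andP[/negbTE -> _] //.
rewrite -[leLHS]ger0_norm ?sumr_ge0 //.
have -> : \sum_(x <- w) `|a x| =
    (\sum_(x <- undup s ++ w) `|a x| - l) - (\sum_(x <- undup s) `|a x| - l).
  by rewrite big_cat opprB addrA subrK addrAC subrr add0r.
by apply: le_trans (ler_normB _ _) _; rewrite (splitr e) lerD // ltW.
Qed.

End Sums.

(** * Multiplication in the monoid *)

Arguments cu_mul : simpl never.

(** The cases carry the leftover word that enters the product; for [j = k] the first two both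
    apply. *)
Variant word_cmp_spec (j k : word) : Prop :=
  | WordPrefix w of k = j ++ w
  | WordExtends w of j = k ++ w
  | WordIncomp of ~~ prefix j k & ~~ prefix k j.

Lemma word_cmpP (j k : word) : word_cmp_spec j k.
Proof.
case: (boolP (prefix j k)) => [/prefixP[w ->]|jk]; first exact: WordPrefix.
case: (boolP (prefix k j)) => [/prefixP[w ->]|kj]; first exact: WordExtends.
exact: WordIncomp.
Qed.

Lemma cu_mul_prefix i j w l : cu_mul (i, j) (j ++ w, l) = Some (i ++ w, l).
Proof. by rewrite /cu_mul prefix_prefix drop_size_cat. Qed.

Lemma cu_mul_extends i k w l : cu_mul (i, k ++ w) (k, l) = Some (i, l ++ w).
Proof.
(* The first test of [cu_mul] can succeed here only if [w] is empty, and then both branches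
   agree. *)
rewrite /cu_mul prefix_prefix drop_size_cat //; case: ifP => // /prefixP[u hu].
have /eqP := congr1 size hu; rewrite !size_cat -addnA -[X in X == _]addn0 eqn_add2l.
rewrite eq_sym addn_eq0 !size_eq0 => /andP[/eqP w0 /eqP u0].
by rewrite w0 addn0 drop_size !cats0.
Qed.

Lemma cu_mul_incomp i j k l : ~~ prefix j k -> ~~ prefix k j ->
  cu_mul (i, j) (k, l) = None.
Proof. by rewrite /cu_mul => /negbTE -> /negbTE ->. Qed.

Lemma prefix_cat2l (k w w' : word) : prefix (k ++ w) (k ++ w') = prefix w w'.
Proof. by rewrite prefix_catr // eqxx. Qed.

(** The middle factor is [s_w^* s_k^* s_k s_w' = s_w^* s_w'], which does not depend on [k]. *)
Lemma cu_mul_cat2l i k k' w w' l :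
  cu_mul (i, k ++ w) (k ++ w', l) = cu_mul (i, k' ++ w) (k' ++ w', l).
Proof. by rewrite /cu_mul !prefix_cat2l !size_cat !drop_cat !ltnNge !leq_addr /= !addKn. Qed.

Lemma prefix_cat_cmp (j k w : word) : prefix j (k ++ w) -> prefix j k || prefix k j.
Proof.
rewrite prefixE take_cat; case: ifP => _; first by rewrite -prefixE => ->.
by move=> /eqP <-; rewrite prefix_prefix orbT.
Qed.

(** Associativity including the zero element, which [obind] propagates as [None]. The two junctions
    [j], [k] and [l], [m] are compared independently, giving nine cases. *)
Lemma cu_mulA p q r :
  obind (fun u => cu_mul u r) (cu_mul p q) = obind (cu_mul p) (cu_mul q r).
Proof.
case: p q r => [i j] [k l] [m n].
case: (word_cmpP j k) => [w ->|w ->|jk kj].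
- rewrite cu_mul_prefix /=.
  case: (word_cmpP l m) => [w' ->|w' ->|lm ml].
  + by rewrite !cu_mul_prefix /= -!catA cu_mul_prefix.
  + by rewrite !cu_mul_extends /= cu_mul_prefix.
  + by rewrite !cu_mul_incomp.
- rewrite cu_mul_extends /=.
  case: (word_cmpP l m) => [w' ->|w' ->|lm ml].
  + by rewrite cu_mul_prefix /= (cu_mul_cat2l _ _ k).
  + by rewrite -catA !cu_mul_extends /= cu_mul_extends catA.
  + rewrite (cu_mul_incomp k n lm ml) /= cu_mul_incomp //.
      by apply: contra lm; apply: catl_prefix.
    by apply/negP => /prefix_cat_cmp; rewrite (negbTE lm) (negbTE ml).
- rewrite (cu_mul_incomp i l jk kj) /=.
  case: (word_cmpP l m) => [w' ->|w' ->|lm ml].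
  + rewrite cu_mul_prefix /= cu_mul_incomp //.
      by apply/negP => /prefix_cat_cmp; rewrite (negbTE jk) (negbTE kj).
    by apply: contra kj; apply: catl_prefix.
  + by rewrite cu_mul_extends /= cu_mul_incomp.
  + by rewrite cu_mul_incomp.
Qed.

Definition cu_star (p : cu) : cu := (p.2, p.1).

(** The involution turns facts about left multiplication into facts about right multiplication. *)
Lemma cu_mul_star p q :
  cu_mul (cu_star q) (cu_star p) = omap cu_star (cu_mul p q).
Proof.
case: p q => [i j] [k l]; rewrite /cu_star /=.
case: (word_cmpP j k) => [w ->|w ->|jk kj].
- by rewrite cu_mul_extends cu_mul_prefix.
- by rewrite cu_mul_extends cu_mul_prefix.
- by rewrite !cu_mul_incomp.
Qed.

Lemma cu_mul_el p : cu_mul cu_e p = Some p.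
Proof. by case: p => k l; rewrite -[k]/([::] ++ k) cu_mul_prefix. Qed.

Lemma cu_mul_er p : cu_mul p cu_e = Some p.
Proof. by case: p => i j; rewrite -[j]/([::] ++ j) cu_mul_extends. Qed.

(** * Rules for sums, and the geometric series *)

Section SumRules.
Variable R : realType.
Local Notation C := (R[i]).
Implicit Types (T U : eqType).

Lemma summableD T (a b : T -> C) :
  summable a -> summable b -> summable (fun x => a x + b x).
Proof. by move=> [M hM] [N hN]; exists (M + N); apply: bounded_byD. Qed.

Lemma summableZ T (c : C) (a : T -> C) : summable a -> summable (fun x => c * a x).
Proof. by move=> [M hM]; exists (`|c| * M); apply: bounded_byZ. Qed.

Lemma summable_le T (a b : T -> C) :
  (forall x, `|a x| <= `|b x|) -> summable b -> summable a.
Proof. by move=> ab [M hM]; exists M; apply: bounded_by_le hM. Qed.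

Lemma sumD T (a b : T -> C) : summable a -> summable b ->
  usum (fun x => a x + b x) = usum a + usum b.
Proof. by move=> ha hb; apply/sumE/has_sumD; apply: has_sum_sum. Qed.

Lemma sumZ T (c : C) (a : T -> C) : summable a ->
  usum (fun x => c * a x) = c * usum a.
Proof. by move=> ha; apply/sumE/has_sumZ; apply: has_sum_sum. Qed.

Lemma sumZr T (c : C) (a : T -> C) : summable a ->
  usum (fun x => a x * c) = usum a * c.
Proof. by move=> ha; rewrite mulrC -sumZ //; apply: eq_sum => x; rewrite mulrC. Qed.

Lemma sum_single T (a : T -> C) x0 :
  (forall x, x != x0 -> a x = 0) -> usum a = a x0.
Proof. by move=> /has_sum_single /sumE. Qed.

Lemma sum0 T : usum (fun _ : T => 0 : C) = 0.
Proof. exact/sumE/has_sum0. Qed.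

(** Put the values of [a] on the graph of [h] and sum over it in both orders. *)
Lemma sum_reindex T U (h : T -> U) (a : U -> C) : injective h -> summable a ->
  (forall u, a u != 0 -> exists t, u = h t) -> usum (fun t => a (h t)) = usum a.
Proof.
move=> hi [M hM] ha.
pose A (p : U * T) := if p.1 == h p.2 then a p.1 else 0.
have hA : summable A.
  exists M; apply: (bounded_by_inj (h := fst)) hM => [[u t] [u' t']|[u t]] /=.
    rewrite /A /=; case: (u =P h t) => [-> _|]; last by rewrite eqxx.
    by case: (u' =P h t') => [-> _ /hi -> //|]; rewrite eqxx.
  by rewrite /A /=; case: ifP; rewrite ?normr0.
transitivity (usum A).
  rewrite sum_pairr //; apply: eq_sum => t.
  rewrite (sum_single (x0 := h t)) /A /= ?eqxx // => u.
  by rewrite /A /= => /negbTE ->.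
rewrite sum_pairl //; apply: eq_sum => u.
have [au|/ha[t ut]] := eqVneq (a u) 0.
  by rewrite au -[RHS](sum0 T); apply: eq_sum => t; rewrite /A /= au if_same.
rewrite (sum_single (x0 := t)) /A /= ?ut ?eqxx // => t'.
by move=> tt'; case: eqP => // /hi e; rewrite e eqxx in tt'.
Qed.

Lemma sum_nat_recl (a : nat -> C) : summable a -> usum a = a 0%N + usum (fun n => a n.+1).
Proof.
move=> ha; pose a0 n := if n is 0%N then a 0%N else 0.
pose a1 n := if n is n'.+1 then a n else 0.
have s0 : summable a0 by apply: summable_le ha => -[|n]; rewrite ?normr0.
have s1 : summable a1 by apply: summable_le ha => -[|n]; rewrite ?normr0.
have <- : usum a0 = a 0%N by rewrite (@sum_single _ a0 0%N) // => -[].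
have <- : usum a1 = usum (fun n => a n.+1).
  rewrite -(sum_reindex succn_inj s1) // => -[|n]; rewrite /a1 ?eqxx // => _.
  by exists n.
rewrite -sumD //; apply: eq_sum => -[|n]; by rewrite /a0 /a1 ?addr0 ?add0r.
Qed.

Lemma ler_sum_subset T (a : T -> C) (s v : seq T) : uniq s -> uniq v ->
  {subset s <= v} -> \sum_(x <- s) `|a x| <= \sum_(x <- v) `|a x|.
Proof.
move=> us uv sv; rewrite [leRHS](bigID (mem s)) /= -[leLHS]addr0 lerD ?sumr_ge0 //.
have hp : perm_eq s [seq i <- v | i \in s].
  apply: uniq_perm; rewrite ?filter_uniq // => x.
  by rewrite mem_filter andb_idr // => /sv.
by rewrite (perm_big _ hp) big_filter.
Qed.

Lemma geometric_bounded (r : C) : 0 <= r -> r < 1 ->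
  bounded_by (fun n : nat => r ^+ n) (1 - r)^-1.
Proof.
move=> r0 r1 s us; pose v := index_iota 0 (\max_(i <- s) i).+1.
have uv : uniq v by exact: iota_uniq.
have sv : {subset s <= v}.
  by move=> x xs; rewrite mem_index_iota ltnS leq_bigmax_seq.
apply: le_trans (ler_sum_subset _ us uv sv) _.
have d0 : 0 < 1 - r by rewrite subr_gt0.
rewrite -[leRHS]mul1r ler_pdivlMr // big_mkord.
rewrite (eq_bigr (fun i : 'I_ _ => r ^+ i)) => [|i _]; last first.
  by rewrite ger0_norm ?exprn_ge0.
rewrite mulrC -opprB mulNr -subrX1 opprB lerBlDr lerDl exprn_ge0 //.
Qed.

End SumRules.

(** * Agreement with sums along an enumeration *)

Section Enumeration.
Variable R : realType.
Local Notation C := (R[i]).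
Variable T : countType.

Let enum n : seq T := pmap (@pickle_inv T) (iota 0 n).

Let enum_uniq n : uniq (enum n).
Proof. by apply: (pmap_uniq (@pickle_invK T)); apply: iota_uniq. Qed.

Let sub_enum (s : seq T) : exists N, forall n, (N <= n)%N -> {subset s <= enum n}.
Proof.
exists (\max_(x <- s) pickle x).+1 => n Nn x xs.
rewrite mem_pmap; apply/mapP; exists (pickle x); last by rewrite pickleK_inv.
by rewrite mem_iota /= add0n (leq_trans _ Nn) // ltnS leq_bigmax_seq.
Qed.

Let sum_enum_at (a : T -> C) n :
  \sum_(k < n) oapp a 0 (@pickle_inv T k) = \sum_(x <- enum n) a x.
Proof.
rewrite -(big_mkord predT (fun k => oapp a 0 (@pickle_inv T k))) /index_iota subn0.
rewrite /enum; elim: (iota 0 n) => [|k s IH]; first by rewrite !big_nil.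
by rewrite big_cons /=; case: pickle_inv => [x|] /=; rewrite ?big_cons IH ?add0r.
Qed.

Lemma enum_boundedE (a : T -> C) M :
  bounded_by a M <-> (forall n : nat, \sum_(k < n) `|enum_at a k| <= M).
Proof.
have nE n : \sum_(k < n) `|enum_at a k| = \sum_(x <- enum n) `|a x|.
  rewrite -sum_enum_at; apply: eq_bigr => k _; rewrite /enum_at.
  by case: pickle_inv => //=; rewrite normr0.
split=> h => [n|s us]; first by rewrite nE h.
have [N /(_ N (leqnn _)) sN] := sub_enum s.
by apply: le_trans (h N); rewrite nE ler_sum_subset.
Qed.

Lemma series_to_unique (a : nat -> C) l l' : series_to a l -> series_to a l' -> l = l'.
Proof.
move=> h h'; apply/eqP; rewrite -subr_eq0; apply/eqP/norm_small0 => e e0.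
have [n hn] := h _ (divr2_gt0 e0); have [n' hn'] := h' _ (divr2_gt0 e0).
have {hn} h1 := ltW (hn (maxn n n') (leq_maxl _ _)).
have {hn'} h2 := ltW (hn' (maxn n n') (leq_maxr _ _)).
apply: le_trans (ler_distD (\sum_(k < maxn n n') a k) _ _) _.
by rewrite distrC (splitr e) lerD.
Qed.

(** Long initial stretches of the enumeration contain any given finite set, so net convergence
    forces convergence of the partial sums to the same value. *)
Lemma sum_toE (a : T -> C) l : summable a -> sum_to a l <-> usum a = l.
Proof.
move=> /has_sum_sum ha.
have h : sum_to a (usum a).
  move=> e e0; have [s hs] := ha e e0; have [N hN] := sub_enum s.
  by exists N => n /hN sn; rewrite sum_enum_at; apply: hs.
by split=> [h'|<- //]; apply: series_to_unique h h'.
Qed.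

Lemma series_toE (a : nat -> C) l : summable a -> series_to a l <-> usum a = l.
Proof.
move=> /has_sum_sum ha.
have h : series_to a (usum a).
  move=> e e0; have [s hs] := ha e e0; exists (\max_(x <- s) x).+1 => n Nn.
  rewrite -(big_mkord predT a); apply: hs; first exact: iota_uniq.
  by move=> x xs; rewrite mem_index_iota (leq_trans _ Nn) // ltnS leq_bigmax_seq.
by split=> [h'|<- //]; apply: series_to_unique h h'.
Qed.

End Enumeration.

(** * The convolution algebra and Neumann series *)

Section Convolution.
Variable R : realType.
Local Notation C := (R[i]).
Implicit Types f g h : cu -> C.

Definition conv_term f g (t : cu) (pq : cu * cu) : C :=
  if cu_mul pq.1 pq.2 == Some t then f pq.1 * g pq.2 else 0.

Definition cv f g (t : cu) : C := usum (conv_term f g t).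

Lemma inAE f : inA f <-> summable f.
Proof. by split=> -[M hM]; exists M; apply/enum_boundedE. Qed.

Lemma bounded_by_mul (T U : eqType) (a : T -> C) (b : U -> C) M N :
  bounded_by a M -> bounded_by b N ->
  bounded_by (fun p : T * U => a p.1 * b p.2) (M * N).
Proof.
move=> ha hb; apply: (bounded_by_prod (m := fun p => `|a p| * N)) => [t|].
  by move: (bounded_byZ (a t) hb).
have N0 := bounded_by_ge0 hb.
rewrite mulrC -(ger0_norm N0); apply: bounded_by_le (bounded_byZ N ha) => x.
by rewrite !normrM !normr_id mulrC.
Qed.

(** A pair contributes to at most one [t], namely its product, so the triples carry no more mass
    than the pairs. *)
Lemma bounded_by_conv_terms f g M N : bounded_by f M -> bounded_by g N ->
  bounded_by (fun x : (cu * cu) * cu => conv_term f g x.2 x.1) (M * N).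
Proof.
move=> hf hg.
have h0 := bounded_by_mul hf hg.
apply: (bounded_by_inj (h := fst)) h0 => [[pq t] [pq' t']|[pq t]] /=; last first.
  by rewrite /conv_term; case: ifP; rewrite ?normr0.
rewrite /conv_term; case: (_ =P Some t) => [e _|]; last by rewrite eqxx.
case: (_ =P Some t') => [e' _ epq|]; last by rewrite eqxx.
by move: e' e; rewrite epq => -> [->].
Qed.

Lemma bounded_by_conv_term f g M N t : bounded_by f M -> bounded_by g N ->
  bounded_by (conv_term f g t) (M * N).
Proof.
move=> hf hg; have := bounded_by_conv_terms hf hg.
by apply: (bounded_by_inj (h := fun pq => (pq, t))) => // x y _ _ [].
Qed.

(** Submultiplicativity of the norm: [cv f g] collects the row sums of the family on triples. *)
Lemma bounded_by_cv f g M N : bounded_by f M -> bounded_by g N ->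
  bounded_by (cv f g) (M * N).
Proof.
move=> hf hg.
apply: (@bounded_by_rows _ _ _ (fun x : cu * (cu * cu) => conv_term f g x.1 x.2)).
  apply: (bounded_by_inj (h := fun x => (x.2, x.1))) (bounded_by_conv_terms hf hg) => //.
  by move=> [x y] [x' y'] _ _ [-> ->].
by move=> t; apply: has_sum_sum; exists (M * N); apply: bounded_by_conv_term.
Qed.

Lemma summable_conv_term f g t : summable f -> summable g -> summable (conv_term f g t).
Proof. by move=> [M hM] [N hN]; exists (M * N); apply: bounded_by_conv_term. Qed.

Lemma summable_cv f g : summable f -> summable g -> summable (cv f g).
Proof. by move=> [M hM] [N hN]; exists (M * N); apply: bounded_by_cv. Qed.

Lemma convE f g h : summable f -> summable g -> conv f g h <-> h = cv f g.
Proof.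
move=> hf hg; have hs t := sum_toE _ (summable_conv_term t hf hg).
split=> [H|-> t]; last exact/hs.
by apply/funext => t; apply/esym/hs/H.
Qed.

Lemma conv_cv f g : summable f -> summable g -> conv f g (cv f g).
Proof. by move=> hf hg; apply/convE. Qed.

Lemma cvDl f f' g : summable f -> summable f' -> summable g ->
  cv (fun t => f t + f' t) g = (fun t => cv f g t + cv f' g t).
Proof.
move=> hf hf' hg; apply/funext => t; rewrite /cv -sumD; try exact: summable_conv_term.
by apply: eq_sum => pq; rewrite /conv_term; case: ifP; rewrite ?mulrDl ?addr0.
Qed.

Lemma cvDr f g g' : summable f -> summable g -> summable g' ->
  cv f (fun t => g t + g' t) = (fun t => cv f g t + cv f g' t).
Proof.
move=> hf hf' hg; apply/funext => t; rewrite /cv -sumD; try exact: summable_conv_term.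
by apply: eq_sum => pq; rewrite /conv_term; case: ifP; rewrite ?mulrDr ?addr0.
Qed.

Lemma cvZl c f g : summable f -> summable g ->
  cv (fun t => c * f t) g = (fun t => c * cv f g t).
Proof.
move=> hf hg; apply/funext => t; rewrite /cv -sumZ; try exact: summable_conv_term.
by apply: eq_sum => pq; rewrite /conv_term; case: ifP; rewrite ?mulrA ?mulr0.
Qed.

Lemma cvZr c f g : summable f -> summable g ->
  cv f (fun t => c * g t) = (fun t => c * cv f g t).
Proof.
move=> hf hg; apply/funext => t; rewrite /cv -sumZ; try exact: summable_conv_term.
by apply: eq_sum => pq; rewrite /conv_term; case: ifP; rewrite ?mulr0 // mulrCA.
Qed.

Lemma bounded_by_delta s : bounded_by (@delta R s) 1.
Proof.
rewrite -(normr1 C) -[1](_ : delta R s s = 1); last by rewrite /delta eqxx.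
by apply: bounded_by_single => x /negbTE xs; rewrite /delta xs.
Qed.

Lemma summable_delta s : summable (@delta R s).
Proof. by exists 1; apply: bounded_by_delta. Qed.

Lemma cv_deltal s f t : summable f ->
  cv (delta R s) f t = usum (fun q => if cu_mul s q == Some t then f q else 0).
Proof.
move=> hf; rewrite /cv sum_pairl; last exact: summable_conv_term (summable_delta s) hf.
rewrite (sum_single (x0 := s)) => [|p /negbTE ps]; last first.
  by rewrite -[RHS](sum0 R cu); apply: eq_sum => q; rewrite /conv_term /delta ps mul0r if_same.
by apply: eq_sum => q; rewrite /conv_term /delta /= eqxx mul1r.
Qed.

Lemma cv_delta s s' t : cv (delta R s) (delta R s') t = (cu_mul s s' == Some t)%:R.
Proof.
rewrite cv_deltal; last exact: summable_delta.
rewrite (sum_single (x0 := s')) => [|q /negbTE qs]; last by rewrite /delta qs if_same.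
by rewrite /delta eqxx; case: ifP.
Qed.

Lemma cv_delta_Some s s' u : cu_mul s s' = Some u -> cv (delta R s) (delta R s') = delta R u.
Proof. by move=> e; apply/funext => t; rewrite cv_delta e /delta eq_sym. Qed.

Lemma cv_delta_None s s' : cu_mul s s' = None ->
  cv (delta R s) (delta R s') = (fun _ => 0).
Proof. by move=> e; apply/funext => t; rewrite cv_delta e. Qed.

Lemma cv_el f : summable f -> cv (delta R cu_e) f = f.
Proof.
move=> hf; apply/funext => t; rewrite cv_deltal // (sum_single (x0 := t)).
  by rewrite cu_mul_el eqxx.
by move=> q qt; rewrite cu_mul_el; case: eqP => // -[] e; rewrite e eqxx in qt.
Qed.

(** A bounded [phi], extended by 0 to the zero element, is a continuous functional, and Fubini
    evaluates it on a product. Taking [phi] as a slice of a third factor gives associativity; taking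
    it as a germ indicator gives the ideal property of zero sums. *)
Lemma cv_test f g (phi : cu -> C) K : summable f -> summable g ->
  (forall t, `|phi t| <= K) ->
  usum (fun t => cv f g t * phi t) =
  usum (fun pq : cu * cu => f pq.1 * g pq.2 * oapp phi 0 (cu_mul pq.1 pq.2)).
Proof.
move=> hf hg hphi.
pose A (x : (cu * cu) * cu) := conv_term f g x.2 x.1 * phi x.2.
have hA : summable A.
  have [[M hM] [N hN]] := (hf, hg).
  exists (`|K| * (M * N)).
  apply: bounded_by_le (bounded_byZ K (bounded_by_conv_terms hM hN)) => x.
  rewrite /A !normrM mulrC ler_wpM2r ?normr_ge0 //.
  have K0 : 0 <= K by apply: le_trans (hphi cu_e).
  by rewrite (ger0_norm K0).
transitivity (usum A).
  rewrite [RHS]sum_pairr //; apply: eq_sum => t.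
  by rewrite /A /= sumZr //; exact: summable_conv_term.
rewrite sum_pairl //; apply: eq_sum => -[p q]; rewrite /A /=.
case e : (cu_mul p q) => [u|] /=; last first.
  by rewrite mulr0 -[RHS](sum0 R cu); apply: eq_sum => t; rewrite /conv_term e mul0r.
rewrite (sum_single (x0 := u)) /conv_term /= e ?eqxx // => t tu.
case: eqP => [[e']|_]; last by rewrite mul0r.
by rewrite e' eqxx in tu.
Qed.

(** Both sides are rearranged into the sum over all triples with product [t]; [cu_mulA] matches the
    two bracketings. *)
Lemma cvA f g h : summable f -> summable g -> summable h ->
  cv (cv f g) h = cv f (cv g h).
Proof.
move=> hf hg hh; apply/funext => t.
have [hfg hgh] := (summable_cv hf hg, summable_cv hg hh).
pose X (x : (cu * cu) * cu) :=
  f x.1.1 * g x.1.2 * h x.2 *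
  (obind (fun u => cu_mul u x.2) (cu_mul x.1.1 x.1.2) == Some t)%:R.
have hX : summable X.
  have [[M hM] [[N hN] [P hP]]] := (hf, (hg, hh)).
  exists (M * N * P).
  apply: bounded_by_le (bounded_by_mul (bounded_by_mul hM hN) hP) => x.
  by rewrite /X; case: eqP => _; rewrite ?mulr1 // mulr0 normr0.
transitivity (usum X).
  rewrite [RHS]sum_pairr // /cv sum_pairr; last exact: summable_conv_term.
  apply: eq_sum => r.
  pose phi u := h r * (cu_mul u r == Some t)%:R.
  transitivity (usum (fun u => cv f g u * phi u)).
    apply: eq_sum => u; rewrite /conv_term /phi /=.
    by case: eqP => _; rewrite ?mulr1 // !mulr0.
  rewrite (cv_test (K := `|h r|)) //; last first.
    by move=> u; rewrite /phi; case: eqP => _; rewrite ?mulr1 // mulr0 normr0.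
  apply: eq_sum => -[p q]; rewrite /X /phi /=.
  by case: (cu_mul p q) => [u|] /=; rewrite ?mulr0 // mulrA.
pose Y (y : cu * (cu * cu)) := X ((y.1, y.2.1), y.2.2).
have XY : has_sum Y (usum X).
  apply: (has_sum_bij (h := fun y => ((y.1, y.2.1), y.2.2))
    (g := fun x => (x.1.1, (x.1.2, x.2)))) (has_sum_sum hX) => //; first by move=> [? []].
  by move=> [[]].
have hY : summable Y.
  have [M hM] := hX; exists M; apply: (bounded_by_inj (h := fun y => ((y.1, y.2.1), y.2.2))) hM => //.
  by move=> [? []] ? ? [? []] ? ? _ _ [-> -> ->].
rewrite -(sumE XY) sum_pairl // [RHS]sum_pairl; last exact: summable_conv_term.
apply: eq_sum => p.
pose phi u := f p * (cu_mul p u == Some t)%:R.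
transitivity (usum (fun u => cv g h u * phi u)); last first.
  apply: eq_sum => u; rewrite /conv_term /phi /=.
  by case: eqP => _; rewrite ?mulr1 ?mulr0 // mulrC.
rewrite (cv_test (K := `|f p|)) //; last first.
  by move=> u; rewrite /phi; case: eqP => _; rewrite ?mulr1 // mulr0 normr0.
apply: eq_sum => -[q r]; rewrite /Y /X /phi /= cu_mulA.
by case: (cu_mul q r) => [u|] /=; rewrite ?mulr0 // [RHS]mulrCA !mulrA.
Qed.

Lemma bounded_by_pow (r : cu -> C) rho (P : nat -> cu -> C) :
  bounded_by r rho -> P 0%N = delta R cu_e -> (forall n, P n.+1 = cv r (P n)) ->
  forall n, bounded_by (P n) (rho ^+ n).
Proof.
move=> hr P0 PS; elim=> [|n IH]; first by rewrite P0; apply: bounded_by_delta.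
by rewrite PS exprS; apply: bounded_by_cv.
Qed.

(** [k] is the sum of the powers of [r]; the equation says that it is a right inverse of
    [delta_e - r]. *)
Lemma neumann (r : cu -> C) rho : bounded_by r rho -> rho < 1 ->
  exists2 k, summable k & k = (fun t => delta R cu_e t + cv r k t).
Proof.
move=> hr rho1; have rho0 := bounded_by_ge0 hr.
pose P n := iter n (cv r) (delta R cu_e).
have hP : forall n, bounded_by (P n) (rho ^+ n) by apply: bounded_by_pow hr _ _.
have hgeo := geometric_bounded rho0 rho1.
have hPP : bounded_by (fun x : nat * cu => P x.1 x.2) (1 - rho)^-1.
  exact: bounded_by_prod hgeo.
have hcol t : summable (fun n => P n t).
  by apply: (summable_col (a := fun x : nat * cu => P x.1 x.2)); exists (1 - rho)^-1.
pose k t := usum (fun n => P n t).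
have hk : summable k.
  exists (1 - rho)^-1.
  apply: (@bounded_by_rows _ _ _ (fun x : cu * nat => P x.2 x.1)).
    apply: (bounded_by_inj (h := fun x => (x.2, x.1))) hPP => //.
    by move=> [? ?] [? ?] _ _ [-> ->].
  by move=> t; exact: (has_sum_sum (hcol t)).
exists k => //; apply/funext => t; rewrite {1}/k sum_nat_recl //; congr (_ + _).
(* Summing over pairs first gives the powers from the first on; summing over [n] first gives
   [cv r k t]. *)
pose A (x : nat * (cu * cu)) := conv_term r (P x.1) t x.2.
have hA : summable A.
  exists (`|rho| * (1 - rho)^-1).
  apply: bounded_by_prod (bounded_byZ rho hgeo) => n /=.
  exact: bounded_by_conv_term.
transitivity (usum A); first by rewrite sum_pairl.
rewrite sum_pairr //; apply: eq_sum => pq.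
rewrite /A /conv_term /=; case: eqP => _; last exact: sum0.
by rewrite sumZ.
Qed.

End Convolution.

(** * Infinite words and the sets T(y,k,x) *)

Definition stream_cat (w : word) (z : nat -> bool) : nat -> bool :=
  fun n => if (n < size w)%N then nth false w n else z (n - size w)%N.

Lemma stream_cat_nil z : stream_cat [::] z = z.
Proof. by apply/funext => n; rewrite /stream_cat /= subn0. Qed.

Lemma stream_cat_cat i k z : stream_cat (i ++ k) z = stream_cat i (stream_cat k z).
Proof.
apply/funext => n; rewrite /stream_cat size_cat nth_cat.
case: (ltnP n (size i)) => h; first by rewrite ltn_addr.
by rewrite ltn_subLR // subnDA.
Qed.

Lemma stream_cat_inj i k z z' : size i = size k ->
  stream_cat i z = stream_cat k z' -> i = k /\ z = z'.
Proof.
move=> sik /(congr1 (fun y : nat -> bool => y _)) e; split.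
  apply: (@eq_from_nth _ false) => // n ni.
  by have := e n; rewrite /stream_cat -sik ni.
apply/funext => n; have := e (size i + n)%N.
by rewrite /stream_cat -sik ltnNge leq_addr /= addKn.
Qed.

Lemma stream_cat_le i k z z' : (size i <= size k)%N ->
  stream_cat i z = stream_cat k z' -> exists2 w, k = i ++ w & z = stream_cat w z'.
Proof.
move=> ik; rewrite -{1}[k](cat_take_drop (size i)) stream_cat_cat.
move=> /stream_cat_inj; rewrite size_take_min (minn_idPl ik) => /(_ erefl)[ei ez].
by exists (drop (size i) k) => //; rewrite {1}ei cat_take_drop.
Qed.

Lemma stream_cat_mkseq n l : stream_cat (mkseq n l) (fun m => n (l + m)%N) = n.
Proof.
apply/funext => m; rewrite /stream_cat size_mkseq.
by case: ltnP => h; rewrite ?nth_mkseq ?subnKC.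
Qed.

(* [(y, d - e, x)] stands for an element of the Cuntz groupoid; [in_germ y x d e]
   cuts out the monoid elements whose partial bijection contains it. *)
Definition in_germ (y x : nat -> bool) (d e : nat) (p : cu) : Prop :=
  exists z, [/\ y = stream_cat p.1 z, x = stream_cat p.2 z
              & (size p.1 + e = size p.2 + d)%N].

Lemma in_germ_star y x d e p : in_germ y x d e p <-> in_germ x y e d (cu_star p).
Proof. by split=> -[z [h1 h2 h3]]; exists z; split. Qed.

(** The element [s_a s_b^*] acts by sending the infinite word [b w] to [a w], with lag [|a| - |b|].
    Undoing this action replaces [a w] by [b w] and subtracts that lag. *)
Lemma in_germ_mull a b w x d e q :
  (exists2 t, cu_mul (a, b) q = Some t & in_germ (stream_cat a w) x d e t) <->
  in_germ (stream_cat b w) x (d + size b) (e + size a) q.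
Proof.
case: q => k l; split.
  case=> t; case: (word_cmpP b k) => [w' ->|w' ->|bk kb].
  - rewrite cu_mul_prefix => -[<-] [z [/= h1 h2 h3]].
    move: h1; rewrite stream_cat_cat => /stream_cat_inj[]// _ hw.
    exists z; split=> //=; first by rewrite stream_cat_cat hw.
    by move: h3; rewrite !size_cat; lia.
  - rewrite cu_mul_extends => -[<-] [z [/= /stream_cat_inj[]// _ hw h2 h3]].
    exists (stream_cat w' z); split=> /=; rewrite -?stream_cat_cat ?hw //.
    by move: h3; rewrite !size_cat; lia.
  - by rewrite cu_mul_incomp.
case=> z [/= h1 h2 h3]; case: (leqP (size b) (size k)) => bk.
  have [w' kE wE] := stream_cat_le bk h1.
  exists (a ++ w', l); first by rewrite kE cu_mul_prefix.
  exists z; split=> //=; first by rewrite wE stream_cat_cat.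
  by move: h3; rewrite kE !size_cat; lia.
have [w' kE wE] := stream_cat_le (ltnW bk) (esym h1).
exists (a, l ++ w'); first by rewrite kE cu_mul_extends.
exists w; split=> //=; first by rewrite stream_cat_cat -wE.
by move: h3; rewrite kE !size_cat; lia.
Qed.

Lemma cu_mul_left a b q t : cu_mul (a, b) q = Some t -> exists w, t.1 = a ++ w.
Proof.
case: q => k l; case: (word_cmpP b k) => [w ->|w ->|bk kb].
- by rewrite cu_mul_prefix => -[<-]; exists w.
- by rewrite cu_mul_extends => -[<-]; exists [::]; rewrite cats0.
- by rewrite cu_mul_incomp.
Qed.

(** Strip nonempty common suffixes as long as there are any; the first word gets shorter each
    time. *)
Lemma core_free_decomposition (p : cu) : exists v w,
  p = (v.1 ++ w, v.2 ++ w) /\ without_symmetric_core v.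
Proof.
have [n] := ubnP (size p.1); elim: n p => // n IH p pn.
have [h|] := pselect (without_symmetric_core p).
  by exists p, [::]; rewrite !cats0; case: (p) h.
move=> /existsNP[m] /existsNP[m'] /existsNP[k] /not_implyP[pE k0].
have [|v [w [[mE m'E] hv]]] := IH (m, m').
  apply: leq_trans (_ : (size m < size p.1)%N) _ => //.
  by rewrite pE /= size_cat -[X in (X < _)%N]addn0 ltn_add2l lt0n size_eq0; apply/eqP.
by exists v, (w ++ k); rewrite pE mE m'E !catA.
Qed.

Definition path_elt (v : cu) (n : nat -> bool) (l : nat) : cu :=
  (v.1 ++ mkseq n l, v.2 ++ mkseq n l).

Lemma path_elt_inj v n : injective (path_elt v n).
Proof.
by move=> l l' [/(congr1 size) + _]; rewrite !size_cat !size_mkseq => /addnI.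
Qed.

(** Equal lag means that [p] and [v] differ by words of equal length on both sides, and the common
    tails force these words to coincide. So [p] extends [v] along [n], or [v] has a common
    suffix. *)
Lemma in_germ_path v n p : without_symmetric_core v ->
  in_germ (stream_cat v.1 n) (stream_cat v.2 n) (size v.1) (size v.2) p <->
  exists l, p = path_elt v n l.
Proof.
move=> hv; split=> [[z [h1 h2 h3]]|[l ->]]; last first.
  exists (fun m => n (l + m)%N); rewrite !stream_cat_cat !stream_cat_mkseq.
  by split=> //=; rewrite !size_cat; lia.
case: (leqP (size v.1) (size p.1)) => vp.
  have [w pE nE] := stream_cat_le vp h1.
  have vp' : (size v.2 <= size p.2)%N by lia.
  have [w' pE' nE'] := stream_cat_le vp' h2.
  have sw : size w = size w' by move: h3; rewrite pE pE' !size_cat; lia.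
  have [ww' _] := stream_cat_inj sw (etrans (esym nE) nE').
  have wn : w = mkseq n (size w).
    apply: (@eq_from_nth _ false); first by rewrite size_mkseq.
    by move=> m mw; rewrite nth_mkseq // nE /stream_cat mw.
  by exists (size w); rewrite /path_elt -wn -pE {1}ww' -pE'; case: (p).
have [w pE nE] := stream_cat_le (ltnW vp) (esym h1).
have vp' : (size p.2 <= size v.2)%N by lia.
have [w' pE' nE'] := stream_cat_le vp' (esym h2).
have sw : size w = size w' by move: h3; rewrite pE pE' !size_cat; lia.
have [ww' _] := stream_cat_inj sw (etrans (esym nE) nE').
(* Here [w] is a common suffix of the two words of [v], hence empty. *)
have w0 : w = [::].
  by apply: (hv p.1 p.2); rewrite {2}ww' -pE -pE'; case: (v).
by move: vp; rewrite pE w0 cats0 ltnn.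
Qed.

(** * The zero-sum condition and its stability under multiplication *)

Section ZeroSums.
Variable R : realType.
Local Notation C := (R[i]).
Implicit Types f g h : cu -> C.

Definition germ_ind y x d e (p : cu) : C := (`[< in_germ y x d e p >])%:R.

(** Quantifying over all germs instead of over core-free elements makes stability under
    multiplication visible; [zero_germ_sumsE] shows that the two conditions agree on summable
    functions. *)
Definition zero_germ_sums f : Prop :=
  forall y x d e, usum (fun p => f p * germ_ind y x d e p) = 0.

Lemma germ_ind_le1 y x d e p : `|germ_ind y x d e p| <= 1.
Proof. by rewrite normr_nat lern1 leq_b1. Qed.

Lemma germ_ind_star y x d e p : germ_ind y x d e p = germ_ind x y e d (cu_star p).
Proof.
rewrite /germ_ind; congr (_%:R); congr nat_of_bool; apply/asboolP/asboolP;
  by rewrite in_germ_star.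
Qed.

(** If [y] does not begin with the first word of [s], no product [s q] lies in the set; otherwise
    [in_germ_mull] names the new germ. *)
Lemma germ_ind_mull y x d e s : 
  (forall q, oapp (germ_ind y x d e) 0 (cu_mul s q) = 0) \/
  exists y' x' d' e', forall q,
    oapp (germ_ind y x d e) 0 (cu_mul s q) = germ_ind y' x' d' e' q.
Proof.
case: s => a b; have [[w ->]|hy] := pselect (exists w, y = stream_cat a w); last first.
  left=> q; case E : (cu_mul _ _) => [t|] //=.
  rewrite /germ_ind asboolF // => -[z [h1 _ _]]; apply: hy.
  have [w tE] := cu_mul_left E.
  by exists (stream_cat w z); rewrite h1 tE stream_cat_cat.
right; exists (stream_cat b w), x, (d + size b)%N, (e + size a)%N => q.
case E : (cu_mul _ _) => [t|] /=; rewrite /germ_ind; last first.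
  by rewrite asboolF // => /in_germ_mull[t]; rewrite E.
congr (_%:R); congr nat_of_bool; apply/asboolP/asboolP.
  by move=> h; apply/in_germ_mull; exists t.
by move=> /in_germ_mull[t']; rewrite E => -[->].
Qed.

Lemma germ_ind_mulr y x d e s : 
  (forall q, oapp (germ_ind y x d e) 0 (cu_mul q s) = 0) \/
  exists y' x' d' e', forall q,
    oapp (germ_ind y x d e) 0 (cu_mul q s) = germ_ind y' x' d' e' q.
Proof.
have E q : oapp (germ_ind y x d e) 0 (cu_mul q s) =
    oapp (germ_ind x y e d) 0 (cu_mul (cu_star s) (cu_star q)).
  by rewrite cu_mul_star; case: (cu_mul q s) => //= t; rewrite germ_ind_star.
have [h|[y' [x' [d' [e' h]]]]] := germ_ind_mull x y e d (cu_star s); [left|right].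
  by move=> q; rewrite E h.
by exists x', y', e', d' => q; rewrite E h [RHS]germ_ind_star.
Qed.

(** By [cv_test] the germ sum of the product is a sum over [p] of [a p] times either 0 or a germ sum
    of [f]. *)
Lemma zero_germ_sums_cvl a f : summable a -> summable f -> zero_germ_sums f ->
  zero_germ_sums (cv a f).
Proof.
move=> ha hf zf y x d e.
rewrite (cv_test (K := 1)) //; last by move=> t; apply: germ_ind_le1.
rewrite sum_pairl; last first.
  have [[M hM] [N hN]] := (ha, hf); exists (M * N).
  apply: bounded_by_le (bounded_by_mul hM hN) => pq.
  rewrite [leLHS]normrM ler_piMr ?normr_ge0 //.
  by case: (cu_mul _ _) => [t|] /=; rewrite ?germ_ind_le1 // normr0 ler01.
rewrite -[RHS](sum0 R cu); apply: eq_sum => p /=.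
have [h|[y' [x' [d' [e' h]]]]] := germ_ind_mull y x d e p.
  by rewrite -[RHS](sum0 R cu); apply: eq_sum => q; rewrite h mulr0.
have E : usum (fun q => a p * (f q * germ_ind y' x' d' e' q)) = 0.
  rewrite sumZ ?zf ?mulr0 //; apply: summable_le hf => q.
  by rewrite normrM ler_piMr ?normr_ge0 ?germ_ind_le1.
by rewrite -[RHS]E; apply: eq_sum => q; rewrite h mulrA.
Qed.

Lemma zero_germ_sums_cvr a f : summable a -> summable f -> zero_germ_sums f ->
  zero_germ_sums (cv f a).
Proof.
move=> ha hf zf y x d e.
rewrite (cv_test (K := 1)) //; last by move=> t; apply: germ_ind_le1.
rewrite sum_pairr; last first.
  have [[M hM] [N hN]] := (hf, ha); exists (M * N).
  apply: bounded_by_le (bounded_by_mul hM hN) => pq.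
  rewrite [leLHS]normrM ler_piMr ?normr_ge0 //.
  by case: (cu_mul _ _) => [t|] /=; rewrite ?germ_ind_le1 // normr0 ler01.
rewrite -[RHS](sum0 R cu); apply: eq_sum => q /=.
have [h|[y' [x' [d' [e' h]]]]] := germ_ind_mulr y x d e q.
  by rewrite -[RHS](sum0 R cu); apply: eq_sum => p; rewrite h mulr0.
have E : usum (fun p => a q * (f p * germ_ind y' x' d' e' p)) = 0.
  rewrite sumZ ?zf ?mulr0 //; apply: summable_le hf => p.
  by rewrite normrM ler_piMr ?normr_ge0 ?germ_ind_le1.
by rewrite -[RHS]E; apply: eq_sum => p; rewrite h mulrCA !mulrA.
Qed.

Lemma summable_germ f y x d e : summable f ->
  summable (fun p => f p * germ_ind y x d e p).
Proof.
move=> hf; apply: summable_le hf => p.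
by rewrite normrM ler_piMr ?normr_ge0 ?germ_ind_le1.
Qed.

Lemma sum_delta s (phi : cu -> C) : usum (fun t => delta R s t * phi t) = phi s.
Proof.
rewrite (sum_single (x0 := s)) /delta ?eqxx ?mul1r // => t /negbTE ->.
by rewrite mul0r.
Qed.

Lemma summable_delta_mul s (phi : cu -> C) : summable (fun t => delta R s t * phi t).
Proof.
exists `|delta R s s * phi s|; apply: bounded_by_single => t /negbTE ts.
by rewrite /delta ts mul0r.
Qed.

Lemma f0E : f0 R = fun t => delta R cu_e t +
  ((-1) * delta R ([:: false], [:: false]) t + (-1) * delta R ([:: true], [:: true]) t).
Proof. by apply/funext => t; rewrite /f0 !mulN1r addrA. Qed.

Lemma summable_f0 : summable (f0 R).
Proof.
by rewrite f0E; apply: summableD; [|apply: summableD; apply: summableZ];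
  apply: summable_delta.
Qed.

Lemma zero_germ_sums_f0 : zero_germ_sums (f0 R).
Proof.
move=> y x d e; set phi := germ_ind _ _ _ _.
have -> : usum (fun p => f0 R p * phi p) =
    phi cu_e + ((-1) * phi ([:: false], [:: false]) + (-1) * phi ([:: true], [:: true])).
  rewrite -!(sum_delta _ phi) -!sumZ; do ?exact: summable_delta_mul.
  rewrite -!sumD; do ?exact: summable_delta_mul; try (apply: summableZ; exact: summable_delta_mul).
    apply: eq_sum => p; rewrite f0E !mulrDl !mulrA //.
  by apply: summableD; apply: summableZ; exact: summable_delta_mul.
(* Exactly one of the two idempotents [s_b s_b^*] matches the first letter of [y], and it lies in
   the set exactly when the identity does; so the three terms cancel. *)
have E b : phi ([:: b], [:: b]) = phi cu_e * (y 0%N == b)%:R.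
  rewrite /phi /germ_ind -natrM mulnb; congr (_%:R); congr nat_of_bool.
  apply/asboolP/andP => /= [[z [/= -> -> h]]|].
    split; last by rewrite /stream_cat.
    apply/asboolP; exists (stream_cat [:: b] z); rewrite !stream_cat_nil.
    by split=> //=; lia.
  case=> /asboolP[z [/= -> ->]]; rewrite !stream_cat_nil => h /eqP zb.
  have zE : z = stream_cat [:: b] (fun n => z n.+1).
    by apply/funext => -[|n]; rewrite /stream_cat //= subn1.
  by exists (fun n => z n.+1); split=> //=; lia.
rewrite !E; case: (y 0%N); rewrite ?mulr1 ?mulr0 ?add0r ?addr0 mulN1r subrr //.
Qed.

Lemma sum_path f v n : summable f -> without_symmetric_core v ->
  usum (fun l => f (path_elt v n l)) =
  usum (fun p => f p * germ_ind (stream_cat v.1 n) (stream_cat v.2 n) (size v.1) (size v.2) p).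
Proof.
move=> hf hv.
rewrite -(sum_reindex (@path_elt_inj v n) (summable_germ _ _ _ _ hf)).
  apply: eq_sum => l; rewrite /germ_ind asboolT ?mulr1 //.
  by apply/in_germ_path => //; exists l.
move=> p; rewrite /germ_ind; case: asboolP => [h|_]; first by move=> _; apply/in_germ_path.
by rewrite mulr0 eqxx.
Qed.

Lemma summable_path f v n : summable f -> summable (fun l => f (path_elt v n l)).
Proof.
move=> [M hM]; exists M.
by apply: (bounded_by_inj (h := path_elt v n)) hM => // l l' _ _ /path_elt_inj.
Qed.

Lemma zero_sums_atE f v : summable f ->
  zero_sums_at f v <-> forall n, usum (fun l => f (path_elt v n l)) = 0.
Proof.
move=> hf; split=> h n.
  by have := h n => /series_toE; apply; apply: summable_path.
by apply/series_toE; [apply: summable_path | apply: h].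
Qed.

(** Conversely, a nonempty set T(y,k,x) contains some [p]; stripping [p] down to its core-free [v]
    exhibits the set as the path of [v] along an infinite word. *)
Lemma zero_germ_sumsE f : summable f ->
  zero_germ_sums f <-> (forall v, without_symmetric_core v -> zero_sums_at f v).
Proof.
move=> hf; split=> [zf v hv|zf y x d e].
  by apply/zero_sums_atE => // n; rewrite sum_path.
have [[p hp]|np] := pselect (exists p, in_germ y x d e p); last first.
  rewrite -[RHS](sum0 R cu); apply: eq_sum => p; rewrite /germ_ind asboolF ?mulr0 //.
  by move=> hp; apply: np; exists p.
have [v [w [pE hv]]] := core_free_decomposition p.
move: hp; rewrite pE => -[z [/=]]; rewrite !stream_cat_cat => -> -> hs.
have /zero_sums_atE h := zf v hv.
rewrite -[RHS](h hf (stream_cat w z)) sum_path //; apply: eq_sum => q; congr (_ * _).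
rewrite /germ_ind; congr (_%:R); congr nat_of_bool.
(* Stripping a common suffix preserves the lag, so [d - e] equals [|v.1| - |v.2|]. *)
have aux a b m n k : (m + k + e = n + k + d -> (a + e = b + d <-> a + n = b + m))%N by lia.
rewrite !size_cat in hs; have {}aux := aux _ _ _ _ _ hs.
by apply/asboolP/asboolP => -[z' [h1 h2 /aux h3]]; exists z'.
Qed.

End ZeroSums.

(** * The forest of elements and its finite boxes *)

Definition child (p : cu) (b : bool) : cu := (p.1 ++ [:: b], p.2 ++ [:: b]).

(** Parents are unique, so the elements form a forest, whose roots are the elements without
    symmetric core. *)
Lemma child_inj p q b c : child p b = child q c -> p = q /\ b = c.
Proof.
case: p q => [i j] [k l] /= [/eqP + /eqP]; rewrite !cats1 !eqseq_rcons.
by move=> /andP[/eqP -> /eqP ->] /andP[/eqP -> _].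
Qed.

Lemma path_eltS v n l : path_elt v n l.+1 = child (path_elt v n l) (n l).
Proof. by rewrite /path_elt /child mkseqS -cats1 !catA. Qed.

(** A fixed way of leaving any box from [p]: keep appending the letter 1, which is [false]. *)
Definition zext (p : cu) (l : nat) : cu := (p.1 ++ nseq l false, p.2 ++ nseq l false).

Lemma zextS p l : zext p l.+1 = child (zext p l) false.
Proof. by rewrite /zext /child -addn1 nseqD !catA. Qed.

Lemma zext_cancel p q l m : zext p l = zext q (m + l) -> p = zext q m.
Proof.
elim: l => [|l IH]; first by rewrite addn0 /zext !cats0; case: p.
by rewrite addnS !zextS => /child_inj[/IH].
Qed.

Lemma path_elt_zext v w l :
  path_elt v (stream_cat w (fun=> false)) (size w + l) = zext (v.1 ++ w, v.2 ++ w) l.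
Proof.
suff E : mkseq (stream_cat w (fun=> false)) (size w + l) = w ++ nseq l false.
  by rewrite /path_elt /zext E !catA.
apply: (@eq_from_nth _ false); first by rewrite size_mkseq size_cat size_nseq.
move=> m; rewrite size_mkseq => ml; rewrite nth_mkseq // /stream_cat nth_cat.
by case: ifP => // _; rewrite nth_nseq if_same.
Qed.

Definition in_box (N : nat) (p : cu) : bool := (size p.1 <= N)%N && (size p.2 <= N)%N.

Lemma in_box_child N p b : in_box N (child p b) -> in_box N p.
Proof.
rewrite /in_box /= !size_cat => /andP[h1 h2].
by rewrite (leq_trans (leq_addr _ _) h1) (leq_trans (leq_addr _ _) h2).
Qed.

Lemma in_box_zext N p l : in_box N (zext p l) -> in_box N p.
Proof.
elim: l => [|l IH]; first by rewrite /zext !cats0; case: p.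
by rewrite zextS => /in_box_child.
Qed.

Fixpoint short_words (N : nat) : seq word :=
  if N is N'.+1 then [::] :: [seq b :: w | b <- [:: false; true], w <- short_words N']
  else [:: [::]].

Lemma mem_short_words N w : (w \in short_words N) = (size w <= N)%N.
Proof.
elim: N w => [|N IH] [|b w]; rewrite ?inE //.
rewrite -[RHS]/(size w <= N)%N -IH.
apply/orP/idP => [[//|/allpairsP[[b' w'] /= [_ h [_ ->]]]] //|h]; right.
by apply/allpairsP; exists (b, w); split=> //; case: b.
Qed.

Lemma box_enum N : exists2 E : seq cu, uniq E & forall p, (p \in E) = in_box N p.
Proof.
exists (undup [seq (i, j) | i <- short_words N, j <- short_words N]).
  exact: undup_uniq.
move=> [i j]; rewrite mem_undup /in_box -!mem_short_words.
apply/allpairsP/andP => [[[i' j'] /= [h1 h2 [-> ->]]] //|[h1 h2]].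
by exists (i, j).
Qed.

(** * Approximation from the ideal generated by [f0] *)

Section Density.
Variable R : realType.
Local Notation C := (R[i]).
Implicit Types f g h : cu -> C.

(** On reversed words, stripping a common suffix is structural recursion on the heads. *)
Fixpoint ancestor_sum_rev f (ri rj : word) {struct ri} : C :=
  f (rev ri, rev rj) +
  match ri, rj with
  | a :: ri', b :: rj' => if a == b then ancestor_sum_rev f ri' rj' else 0
  | _, _ => 0
  end.

(* Sum of [f] over all elements obtained from [p] by stripping a common suffix. *)
Definition ancestor_sum f (p : cu) : C := ancestor_sum_rev f (rev p.1) (rev p.2).

Lemma ancestor_sum_child f p b :
  ancestor_sum f (child p b) = f (child p b) + ancestor_sum f p.
Proof. by rewrite /ancestor_sum /child /= !cats1 !rev_rcons /= eqxx !rev_cons !revK. Qed.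

Lemma ancestor_sum_orphan f p : (forall q b, p <> child q b) -> ancestor_sum f p = f p.
Proof.
have E ri rj : (forall q b, (rev ri, rev rj) <> child q b) ->
    ancestor_sum_rev f ri rj = f (rev ri, rev rj).
  case: ri rj => [|a ri] [|b rj] np /=; rewrite ?addr0 //.
  case: eqP => [ab|_]; rewrite ?addr0 //.
  by case: (np (rev ri, rev rj) b); rewrite ab /child /= !rev_cons !cats1.
by case: p => i j np; rewrite /ancestor_sum E !revK.
Qed.

Lemma core_free_orphan v : without_symmetric_core v -> forall q b, v <> child q b.
Proof. by move=> hv q b /hv. Qed.

(** As [v] is a root, the element itself and its ancestors are the path elements with indices from 0
    to [l]. *)
Lemma ancestor_sum_path f v n l : without_symmetric_core v ->
  ancestor_sum f (path_elt v n l) = \sum_(k < l.+1) f (path_elt v n k).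
Proof.
move=> hv; elim: l => [|l IH].
  rewrite big_ord1 ancestor_sum_orphan // /path_elt !cats0 => q b.
  by case: (v) hv => i j hv; exact: core_free_orphan.
by rewrite big_ord_recr /= -IH path_eltS ancestor_sum_child addrC.
Qed.

Lemma sum_nat_split (a : nat -> C) m : summable a ->
  usum a = \sum_(k < m) a k + usum (fun n => a (m + n)%N).
Proof.
move=> ha; elim: m => [|m IH]; first by rewrite big_ord0 add0r.
rewrite big_ord_recr /= IH -addrA; congr (_ + _); rewrite sum_nat_recl ?addn0.
  by congr (_ + _); apply: eq_sum => n; rewrite addnS.
have [M hM] := ha; exists M; apply: (bounded_by_inj (h := addn m)) hM => //.
by move=> x y _ _ /addnI.
Qed.

(** [p] lies on the path that runs from its root [v] through [w] and then appends [false] forever.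
    The total along this path is 0, so the part up to [p] is minus the rest. *)
Lemma ancestor_sum_zext f p : summable f -> zero_germ_sums f ->
  ancestor_sum f p = - usum (fun l => f (zext p l.+1)).
Proof.
move=> hf zf; have [v [w [-> hv]]] := core_free_decomposition p.
set n := stream_cat w (fun=> false).
(* The element [p] has index [size w] on the path and belongs to the first part, hence the
   successor. *)
have := sum_path n hf hv; rewrite zf (sum_nat_split (size w).+1); last exact: summable_path.
rewrite -ancestor_sum_path // => /eqP; rewrite addr_eq0 => /eqP.
have -> : path_elt v n (size w) = (v.1 ++ w, v.2 ++ w).
  by rewrite -[X in path_elt _ _ X]addn0 path_elt_zext /zext !cats0.
by move=> ->; congr (- _); apply: eq_sum => l; rewrite -path_elt_zext addSnnS.
Qed.

Definition on_boundary N (p : cu) : bool :=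
  ~~ in_box N p && `[< exists q b, p = child q b /\ in_box N q >].

(** If the path from [q] reached [p] after a positive number of steps, it would pass through the
    parent of [p], which is in the box; but then [q] would be in the box as well. *)
Lemma boundary_zext_inj N p q l m : on_boundary N p -> on_boundary N q ->
  zext p l = zext q (m + l) -> m = 0%N.
Proof.
move=> /andP[_ /asboolP[p' [b [pE hp']]]] /andP[hq _] /zext_cancel.
case: m => // m; rewrite pE zextS => /child_inj[p'E _].
by case/negP: hq; apply: (@in_box_zext _ _ m); rewrite -p'E.
Qed.

(** On the boundary the ancestor sum is minus a sum of [f] along a [zext] path. These paths stay
    outside the box and are pairwise disjoint, so together they use no more than the mass of [f]
    there. *)
Lemma bounded_by_boundary N f M : summable f -> zero_germ_sums f ->
  bounded_by (fun p => if in_box N p then 0 else f p) M ->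
  bounded_by (fun p => if on_boundary N p then ancestor_sum f p else 0) M.
Proof.
move=> hf zf hM.
pose A (x : cu * nat) := if on_boundary N x.1 then - f (zext x.1 x.2.+1) else 0.
apply: (@bounded_by_rows _ _ _ A) => [|p]; last first.
  rewrite /A /=; case: ifP => _; last exact: has_sum0.
  rewrite ancestor_sum_zext // -mulN1r.
  apply: eq_has_sum (has_sumZ (-1) (has_sum_sum _)) => [l|]; first by rewrite mulN1r.
  have [K hK] := hf; exists K; apply: (bounded_by_inj (h := fun l => zext p l.+1)) hK => //.
  move=> l l' _ _ /(congr1 (fun q : cu => size q.1)).
  by rewrite !size_cat !size_nseq => /addnI [].
apply: (bounded_by_inj (h := fun x => zext x.1 x.2.+1)) hM => [[p l] [q m]|[p l]] /=.
  rewrite /A /=; case: ifP => [hp _|_]; last by rewrite eqxx.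
  case: ifP => [hq _|_]; last by rewrite eqxx.
  wlog lm : p q l m hp hq / (l <= m)%N => [H E|E].
    case: (leqP l m) => [lm|/ltnW ml]; first exact: H.
    by apply/esym; apply: H => //; apply/esym.
  have E' : zext p l.+1 = zext q ((m - l) + l.+1) by rewrite addnS subnK.
  have ml := boundary_zext_inj hp hq E'; rewrite ml in E'.
  move/zext_cancel: E' => ->; rewrite /zext !cats0.
  by congr (_, _); [case: (q) | apply/eqP; rewrite eqn_leq lm -subn_eq0 ml].
rewrite /A /=; case: ifP => [/andP[hp _]|_]; last by rewrite normr0.
case: ifP => [/in_box_zext h|_]; last by rewrite normrN.
by rewrite h in hp.
Qed.

(** For [p = (i, j)] this is the two-sided translate of [f0] by [s_i] and [s_j^*], see
    [relatorE]. *)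
Definition relator (p : cu) : cu -> C := fun t =>
  delta R p t + ((-1) * delta R (child p false) t + (-1) * delta R (child p true) t).

Lemma sum_seq_delta (E : seq cu) (c : cu -> C) t : uniq E ->
  \sum_(p <- E) c p * delta R p t = if t \in E then c t else 0.
Proof.
move=> uE; case: ifP => tE.
  rewrite (bigD1_seq t) //= /delta eqxx mulr1 big1 ?addr0 // => p pt.
  by rewrite eq_sym (negbTE pt) mulr0.
rewrite big_seq big1 // => p pE; rewrite /delta.
by case: eqP => [e|]; rewrite ?mulr0 // -e tE in pE *.
Qed.

Lemma sum_seq_delta_child (E : seq cu) (c : cu -> C) q b b' : uniq E ->
  \sum_(p <- E) c p * delta R (child p b') (child q b) =
  if (b == b') && (q \in E) then c q else 0.
Proof.
move=> uE; transitivity (\sum_(p <- E) (b == b')%:R * (c p * delta R p q)).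
  apply: eq_bigr => p _; rewrite mulrCA; congr (_ * _).
  rewrite /delta -natrM mulnb; congr (_%:R); congr nat_of_bool.
  by apply/eqP/andP => [/child_inj[-> ->]|[/eqP -> /eqP ->]].
rewrite -mulr_sumr sum_seq_delta //.
by case: (b == b'); rewrite ?mul1r ?mul0r.
Qed.

(** Write F for the ancestor sum. Inside the box the combination telescopes to F at [t] minus F at
    its parent, which is [f t]. On the boundary only the term of the parent survives and the error
    is minus F at [t]; elsewhere outside the box the error is [- f t]. Each kind of error has mass
    at most [M]. *)
Lemma approximation N (E : seq cu) f M : uniq E ->
  (forall p, (p \in E) = in_box N p) ->
  summable f -> zero_germ_sums f ->
  bounded_by (fun p => if in_box N p then 0 else f p) M ->
  bounded_by (fun t => \sum_(p <- E) ancestor_sum f p * relator p t - f t) (M + M).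
Proof.
move=> uE hE hf zf hM.
have hB := bounded_by_boundary hf zf hM.
have hn (a : cu -> C) : bounded_by a M -> bounded_by (fun t => `|a t|) M.
  by apply: bounded_by_le => t; rewrite normr_id.
apply: bounded_by_le (bounded_byD (hn _ hM) (hn _ hB)) => t.
rewrite [leRHS]ger0_norm ?addr_ge0 ?normr_ge0 //.
have -> : \sum_(p <- E) ancestor_sum f p * relator p t =
    (if in_box N t then ancestor_sum f t else 0) -
    (\sum_(p <- E) ancestor_sum f p * delta R (child p false) t +
     \sum_(p <- E) ancestor_sum f p * delta R (child p true) t).
  rewrite -hE -sum_seq_delta // opprD -!sumrN -!big_split /=; apply: eq_bigr => p _.
  by rewrite /relator !mulrDr !mulN1r !mulrN.
have [[q [b tE]]|np] := pselect (exists q b, t = child q b); last first.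
  have E0 b : \sum_(p <- E) ancestor_sum f p * delta R (child p b) t = 0.
    rewrite big1 // => p _; rewrite /delta; case: eqP => [tE|]; rewrite ?mulr0 //.
    by case: np; exists p, b.
  rewrite !E0 addr0 subr0; case: ifP => tN.
    rewrite ancestor_sum_orphan ?subrr ?normr0 ?addr_ge0 ?normr_ge0 //.
    by move=> q b tE; apply: np; exists q, b.
  by rewrite sub0r normrN lerDl normr_ge0.
have -> : \sum_(p <- E) ancestor_sum f p * delta R (child p false) t +
    \sum_(p <- E) ancestor_sum f p * delta R (child p true) t =
    if in_box N q then ancestor_sum f q else 0.
  rewrite tE !sum_seq_delta_child // hE; case: (b) => /=; rewrite ?addr0 ?add0r //.
case: ifP => tN.
  have -> : in_box N q by move: tN; rewrite tE => /in_box_child.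
  rewrite tE ancestor_sum_child addrK subrr normr0 addr_ge0 ?normr_ge0 //.
case: ifP => qN.
  have -> : on_boundary N t.
    by rewrite /on_boundary tN; apply/asboolP; exists q, b.
  by rewrite sub0r -opprD normrN [in leLHS]addrC tE -ancestor_sum_child lerDr normr_ge0.
by rewrite subr0 sub0r normrN lerDl normr_ge0.
Qed.

Lemma relatorE p : relator p =
  cv (cv (delta R (p.1, [::])) (f0 R)) (delta R ([::], p.2)).
Proof.
case: p => i j /=; have sd := @summable_delta R.
have m1 b : cu_mul (i, [::]) ([:: b], [:: b]) = Some (i ++ [:: b], [:: b]) by [].
have m2 b : cu_mul (i ++ [:: b], [:: b]) ([::], j) = Some (child (i, j) b).
  by rewrite -[X in cu_mul (_, X)]/([::] ++ [:: b]) cu_mul_extends.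
have m3 : cu_mul (i, [::]) ([::], j) = Some (i, j).
  by rewrite -[X in cu_mul _ (X, _)]/([::] ++ [::]) cu_mul_prefix cats0.
have d1 b := @cv_delta_Some R _ _ _ (m1 b).
have d2 b := @cv_delta_Some R _ _ _ (m2 b).
rewrite f0E !(cvDr, cvZr); do ?[exact: sd | apply: summableZ | apply: summableD].
rewrite !d1 (cv_delta_Some R (cu_mul_er _)).
rewrite !(cvDl, cvZl); do ?[exact: sd | apply: summableZ | apply: summableD].
by rewrite !d2 (cv_delta_Some R m3).
Qed.

Lemma ideal_sum I (E : seq cu) (F : cu -> cu -> C) : is_ideal I ->
  (forall p, I (F p)) -> I (fun t => \sum_(p <- E) F p t).
Proof.
move=> [_ [I0 ID _ _ _]] hF; elim: E => [|p E IH].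
  by rewrite (_ : (fun _ => _) = fun _ => 0) //; apply/funext => t; rewrite big_nil.
rewrite (_ : (fun _ => _) = fun t => F p t + \sum_(q <- E) F q t); first exact: ID.
by apply/funext => t; rewrite big_cons.
Qed.

Lemma ideal_relator I p : is_ideal I -> I (f0 R) -> I (relator p).
Proof.
move=> [IA [_ _ _ Il Ir]] If0; have sd := @summable_delta R.
have h1 : I (cv (delta R (p.1, [::])) (f0 R)).
  by apply: Il If0 _; [exact/inAE | apply: conv_cv; [exact: sd | exact: summable_f0]].
rewrite relatorE; apply: (Ir _ _ _ _ h1); first exact/inAE.
apply: conv_cv; last exact: sd.
exact/inAE/IA.
Qed.

Lemma closed_approx I f : is_closed I -> inA f ->
  (forall e : C, 0 < e -> exists2 u, I u & bounded_by (fun t => u t - f t) e) -> I f.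
Proof.
move=> Ic fA h.
have /choice[u hu] : forall n : nat, exists u, I u /\ bounded_by (fun t => u t - f t) n.+1%:R^-1.
  by move=> n; have [|u] := h n.+1%:R^-1; [rewrite invr_gt0 ltr0Sn | exists u].
apply: (Ic u) => // [n|e e0]; first by case: (hu n).
(* A positive complex number is real, so the Archimedean bound can be taken for [Re e]. *)
have e0' : 0 < complex.Re e by move: e0; rewrite ltcE => /andP[].
have eE : (complex.Re e)%:C%C = e by rewrite RRe_real // gtr0_real.
have hN : (complex.Re e)^-1 < (Num.bound (complex.Re e)^-1)%:R.
  by apply: archi_boundP; rewrite invr_ge0 ltW.
exists (Num.bound (complex.Re e)^-1) => n Nn; apply/enum_boundedE.
apply: bounded_by_trans (hu n).2;
have -> : n.+1%:R^-1 = (n.+1%:R^-1 : R)%:C%C :> C by rewrite fmorphV rmorph_nat.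
rewrite -eE lecR.
rewrite -[leRHS]invrK lef_pV2 ?posrE ?ltr0Sn ?invr_gt0 //.
by apply: ltW; apply: lt_le_trans hN _; rewrite ler_nat leqW.
Qed.

Lemma zero_germ_sums_inJ f : summable f -> zero_germ_sums f -> inJ f.
Proof.
move=> hf zf I Iid Ic If0; apply: closed_approx => // [|e e0]; first exact/inAE.
have [M hM] := hf; have [s us hs] := summable_tail hM (divr2_gt0 e0).
(* The box of size [N] contains [s], so outside it [f] has mass at most [e / 2]. *)
pose N := \max_(p <- s) maxn (size p.1) (size p.2).
have hN : bounded_by (fun p => if in_box N p then 0 else f p) (e / 2).
  apply: bounded_by_le hs => p; case: ifP => [_|pN]; first by rewrite normr0.
  case: ifP => // ps; move: pN; rewrite /in_box -geq_max.
  by rewrite (leq_bigmax_seq (F := fun p : cu => maxn (size p.1) (size p.2))).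
have [E uE hE] := box_enum N.
exists (fun t => \sum_(p <- E) ancestor_sum f p * relator p t); last first.
  by rewrite (splitr e); apply: approximation.
apply: ideal_sum => // p; have [_ [_ _ IZ _ _]] := Iid; apply: IZ.
exact: ideal_relator.
Qed.

End Density.

(** * Compression between long prefixes and an aperiodic word *)

(* A word without any period between [1] and [K]. *)
Definition marker (K : nat) : word := nseq K false ++ [:: true].

Lemma size_marker K : size (marker K) = K.+1.
Proof. by rewrite size_cat size_nseq addn1. Qed.

Lemma nth_marker K n : nth false (marker K) n = (n == K).
Proof.
rewrite nth_cat size_nseq nth_nseq if_same; case: ltngtP => // [nK|->].
  by rewrite -subn_gt0 in nK; case: (n - K)%N nK => // k _; rewrite nth_default.
by rewrite subnn.
Qed.

(** The letter 2 that ends the first word sits at position [|al| + K]. Since [|be| <= K], this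
    position falls into the second marker, whose only letter 2 is at [|be| + K]; so the lengths
    agree. *)
Lemma prefix_marker K (al be : word) : (size be <= K)%N ->
  prefix (al ++ marker K) (be ++ marker K) -> al = be.
Proof.
move=> beK /prefixP[u E].
have sE : size be = (size al + size u)%N.
  by have := congr1 size E; rewrite (size_cat be) (size_cat _ u) (size_cat al) size_marker; lia.
have : nth false (be ++ marker K) (size al + K) = true.
  by rewrite E -catA nth_cat ltnNge leq_addr /= addKn nth_cat size_marker ltnSn nth_marker eqxx.
rewrite nth_cat nth_marker ifF; last by lia.
move=> /eqP h; have sab : size be = size al by lia.
move/eqP: E; rewrite -catA eqseq_cat //.
by case/andP => /eqP.
Qed.

Lemma prefix_catl_short (l b w : word) : (size l <= size b)%N ->
  prefix l (b ++ w) = prefix l b.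
Proof. by move=> h; rewrite !prefixE takel_cat. Qed.

(** Since [(a, b)] itself lies in the set, a member whose words are no longer than [a] and [b] must
    arise from it by stripping a common suffix. *)
Lemma in_germ_common_tail y x d e a b z k l :
  y = stream_cat a z -> x = stream_cat b z -> (size a + e = size b + d)%N ->
  (size k <= size a)%N -> (size l <= size b)%N ->
  in_germ y x d e (k, l) <-> exists2 al, a = k ++ al & b = l ++ al.
Proof.
move=> yE xE hs ka lb; split=> [[z' [/= h1 h2 h3]]|[al aE bE]].
  have [al aE zE] := stream_cat_le ka (etrans (esym h1) yE).
  have [be bE zE'] := stream_cat_le lb (etrans (esym h2) xE).
  have sab : size al = size be by move: hs h3; rewrite aE bE !size_cat; lia.
  have [ab _] := stream_cat_inj sab (etrans (esym zE) zE').
  by exists al; rewrite // ab.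
exists (stream_cat al z); split=> /=; rewrite -?stream_cat_cat -?aE -?bE //.
by move: hs; rewrite aE bE !size_cat; lia.
Qed.

(** The product is [s_(a m)^* s_k s_l^* s_(b m)]. It vanishes unless [a = k al] and [b = l be], and
    then it equals [s_(al m)^* s_(be m)]: the identity when [al = be], and zero otherwise because
    [m] has no short period. *)
Lemma compress_elt y x d e a b z p :
  y = stream_cat a z -> x = stream_cat b z -> (size a + e = size b + d)%N ->
  (size p.1 <= size a)%N -> (size p.2 <= size b)%N ->
  let m := marker (size a + size b) in
  obind (fun u => cu_mul u (b ++ m, [::])) (cu_mul ([::], a ++ m) p) =
  if `[< in_germ y x d e p >] then Some cu_e else None.
Proof.
case: p => k l yE xE hs ka lb m.
have germE := in_germ_common_tail yE xE hs ka lb.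
have sm : size m = (size a + size b).+1 by exact: size_marker.
have pm al be : (size be <= size a + size b)%N -> prefix (al ++ m) (be ++ m) -> al = be.
  exact: prefix_marker.
clearbody m; rewrite /= in ka lb germE.
case: (boolP (prefix k a)) => [/prefixP[al aE]|nk]; last first.
  rewrite asboolF; last first.
    by move=> /germE[al aE _]; rewrite aE prefix_prefix in nk.
  rewrite cu_mul_incomp //; last by rewrite prefix_catl_short.
  by apply/negP => /prefixP[u /(congr1 size)]; rewrite !size_cat sm; move: ka => /=; lia.
rewrite {1}aE -catA cu_mul_extends /=.
case: (boolP (prefix l b)) => [/prefixP[be bE]|nl]; last first.
  rewrite asboolF; last first.
    by move=> /germE[al' _ bE]; rewrite bE prefix_prefix in nl.
  rewrite cu_mul_incomp //.
    by apply/negP => /catl_prefix; rewrite prefix_catl_short // (negbTE nl).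
  apply/negP => /prefix_cat_cmp; rewrite (prefix_catl_short _ lb) (negbTE nl) orbF.
  by move=> /prefixP[u /(congr1 size)]; rewrite !size_cat sm; move: lb => /=; lia.
have [ab|ab] := eqVneq al be.
  rewrite asboolT; last by apply/germE; exists al; rewrite // ab.
  by rewrite ab {1}bE -catA -[l ++ _]cats0 -{2}[l ++ _]cats0 cu_mul_prefix.
rewrite asboolF; last first.
  move=> /germE[ga]; rewrite {1}aE {1}bE => /eqP + /eqP.
  by rewrite !eqseq_cat // !eqxx /= => /eqP e1 /eqP e2; rewrite e1 e2 eqxx in ab.
have alK : (size al <= size a + size b)%N.
  by rewrite aE size_cat -addnA addnCA leq_addr.
have beK : (size be <= size a + size b)%N.
  by rewrite bE size_cat addnA leq_addl.
rewrite {1}bE -catA (cu_mul_cat2l _ _ [::]) /= cu_mul_incomp //.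
  by apply/negP => /(pm _ _ beK) h; rewrite h eqxx in ab.
by apply/negP => /(pm _ _ alK) h; rewrite h eqxx in ab.
Qed.

(** * Inverting elements with a nonzero germ sum *)

Section Invertibility.
Variable R : realType.
Local Notation C := (R[i]).
Implicit Types f g h : cu -> C.

Lemma sum_finite (T : eqType) (s : seq T) (a : T -> C) : uniq s ->
  usum (fun x => if x \in s then a x else 0) = \sum_(x <- s) a x.
Proof.
move=> us; apply: sumE => e e0; exists s => v uv sv.
suff -> : \sum_(x <- v) (if x \in s then a x else 0) = \sum_(x <- s) a x.
  by rewrite subrr normr0.
have hp : perm_eq s [seq x <- v | x \in s].
  apply: uniq_perm; rewrite ?filter_uniq // => x.
  by rewrite mem_filter andb_idr // => /sv.
by rewrite (perm_big _ hp) big_filter [RHS]big_mkcond.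
Qed.

Lemma summable_finite (s : seq cu) (c : cu -> C) :
  summable (fun t => \sum_(p <- s) c p * delta R p t).
Proof.
elim: s => [|p s IH].
  by exists 0; apply: bounded_by_le (@bounded_by0 R cu) => t; rewrite big_nil.
rewrite (_ : (fun _ => _) = fun t => c p * delta R p t + \sum_(q <- s) c q * delta R q t).
  by apply: summableD => //; apply: summableZ; apply: summable_delta.
by apply/funext => t; rewrite big_cons.
Qed.

Lemma cv0r f : cv f (fun _ => 0) = fun _ => 0.
Proof.
apply/funext => t; rewrite /cv -[RHS](sum0 R (cu * cu)%type); apply: eq_sum => pq.
by rewrite /conv_term mulr0 if_same.
Qed.

Lemma cv0l f : cv (fun _ => 0) f = fun _ => 0.
Proof.
apply/funext => t; rewrite /cv -[RHS](sum0 R (cu * cu)%type); apply: eq_sum => pq.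
by rewrite /conv_term mul0r if_same.
Qed.

Lemma compress_finite A B (P : pred cu) (s : seq cu) (c : cu -> C) :
  (forall p, p \in s -> obind (fun u => cu_mul u B) (cu_mul A p) =
     if P p then Some cu_e else None) ->
  cv (cv (delta R A) (fun t => \sum_(p <- s) c p * delta R p t)) (delta R B) =
  fun t => (\sum_(p <- s) c p * (P p)%:R) * delta R cu_e t.
Proof.
have sd := @summable_delta R; elim: s => [|p s IH] h.
  rewrite (_ : (fun _ => _) = fun _ => 0); last first.
    by apply/funext => t; rewrite big_nil.
  by rewrite cv0r cv0l; apply/funext => t; rewrite big_nil mul0r.
have hs := summable_finite s c.
rewrite (_ : (fun _ => _) = fun t => c p * delta R p t + \sum_(q <- s) c q * delta R q t);
  last by apply/funext => t; rewrite big_cons.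
rewrite cvDr ?cvZr //; try exact: summableZ.
rewrite cvDl ?cvZl //; try exact: summable_cv; try (apply: summableZ; exact: summable_cv).
rewrite IH; last by move=> q qs; apply: h; rewrite in_cons qs orbT.
have E : cv (cv (delta R A) (delta R p)) (delta R B) =
    fun t => (P p)%:R * delta R cu_e t.
  have := h p (mem_head _ _); case Eu : (cu_mul A p) => [u|] /=.
    rewrite (cv_delta_Some R Eu); case: (P p) => hu.
      by rewrite (cv_delta_Some R hu); apply/funext => t; rewrite mul1r.
    by rewrite (cv_delta_None R hu); apply/funext => t; rewrite mul0r.
  rewrite (cv_delta_None R Eu) cv0l; case: (P p) => // _.
  by apply/funext => t; rewrite mul0r.
by rewrite E; apply/funext => t; rewrite big_cons mulrDl mulrA.
Qed.

(** The compression is [c] times [delta_e + r / c] with [r / c] of norm below 1. Its right inverse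
    from the Neumann series is absorbed into the right factor. *)
Lemma invertible_of_compress f A B (c : C) r M : summable f ->
  cv (cv (delta R A) f) (delta R B) = (fun t => c * delta R cu_e t + r t) ->
  bounded_by r M -> M < `|c| -> two_sided_invertible f.
Proof.
move=> hf hW hr Mc; have sd := @summable_delta R.
have c0' : 0 < `|c| by apply: le_lt_trans (bounded_by_ge0 hr) Mc.
have c0 : c != 0 by rewrite -normr_gt0.
have sr : summable r by exists M.
have [|k sk kE] := neumann (bounded_byZ (- c^-1) hr).
  by rewrite normrN normfV mulrC ltr_pdivrMr // mul1r.
have sg : summable (cv (delta R A) f) by apply: summable_cv.
have sck : summable (fun t => c^-1 * k t) by apply: summableZ.
exists (delta R A), (cv (delta R B) (fun t => c^-1 * k t)), (cv (delta R A) f).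
split; [exact/inAE | exact/inAE/summable_cv | exact: conv_cv |].
apply/convE => //; first exact: summable_cv.
rewrite -cvA // hW cvZr //; last by apply: summableD => //; apply: summableZ.
rewrite cvDl //; last exact: summableZ.
rewrite cvZl // cv_el //; apply/funext => t.
have := congr1 (fun g => g t) kE; rewrite cvZl // => /eqP.
rewrite mulNr -subr_eq opprK => /eqP; rewrite /delta_e => <-.
by rewrite mulrDr mulKf.
Qed.

Lemma invertible_of_germ_sum f : summable f -> ~ zero_germ_sums f ->
  two_sided_invertible f.
Proof.
move=> hf /existsNP[y] /existsNP[x] /existsNP[d] /existsNP[e] /eqP.
set phi := germ_ind R y x d e; set c := usum _ => c0.
have c0' : 0 < `|c| by rewrite normr_gt0.
have [p0 [z0 [yE xE hs]]] : exists p, in_germ y x d e p.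
  apply: contrapT => np; case/eqP: c0; rewrite -[RHS](sum0 R cu); apply: eq_sum => p.
  by rewrite /phi /germ_ind asboolF ?mulr0 // => hp; apply: np; exists p.
(* With a tail of mass at most [|c| / 4], the finite part has a germ sum [c'] of modulus at least
   [3 |c| / 4], which exceeds the compressed tail. *)
have [M hM] := hf; have q0 := divr2_gt0 (divr2_gt0 c0').
have [s us hs2] := summable_tail hM q0.
pose c' := \sum_(p <- s) f p * phi p.
pose f2 p := if p \in s then 0 else f p.
have sf2 : summable f2 by exists (`|c| / 2 / 2).
have fE : f = fun t => \sum_(p <- s) f p * delta R p t + f2 t.
  by apply/funext => t; rewrite sum_seq_delta // /f2; case: ifP; rewrite ?addr0 ?add0r.
have cc' : `|c - c'| <= `|c| / 2 / 2.
  have -> : c - c' = usum (fun p => f2 p * phi p).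
    rewrite /c' -sum_finite // -mulN1r -sumZ; last first.
      by apply: summable_le (summable_germ y x d e hf) => p; case: ifP; rewrite ?normr0 ?normr_ge0.
    rewrite -sumD; first last.
    - apply: summableZ.
      by apply: summable_le (summable_germ y x d e hf) => p; case: ifP; rewrite ?normr0 ?normr_ge0.
    - exact: summable_germ.
    by apply: eq_sum => p; rewrite /f2; case: ifP; rewrite ?mulr0 ?addr0 // mulN1r subrr mul0r.
  apply: has_sum_norm_le (has_sum_sum (summable_germ _ _ _ _ sf2)).
  apply: bounded_by_le hs2 => p.
  by rewrite [leLHS]normrM ler_piMr ?normr_ge0 ?germ_ind_le1.
have c'big : `|c| / 2 / 2 < `|c'|.
  have : `|c| <= `|c| / 2 / 2 + `|c'|.
    by rewrite -{1}[c](subrK c'); apply: le_trans (ler_normD _ _) _; rewrite lerD2r.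
  rewrite {1}(splitr `|c|) {1 2}(splitr (`|c| / 2)) -addrA lerD2l.
  by apply: lt_le_trans; rewrite ltrDl addr_gt0.
(* Prolonging [p0] by [Q] letters of the tail [z0] makes [a] and [b] at least as long as the words
   of every element of [s], as [compress_elt] requires. *)
pose Q := \max_(p <- s) maxn (size p.1) (size p.2).
pose a := p0.1 ++ mkseq z0 Q; pose b := p0.2 ++ mkseq z0 Q.
pose z1 m := z0 (Q + m)%N.
have yE' : y = stream_cat a z1 by rewrite stream_cat_cat stream_cat_mkseq.
have xE' : x = stream_cat b z1 by rewrite stream_cat_cat stream_cat_mkseq.
have hs' : (size a + e = size b + d)%N by rewrite /a /b !size_cat; lia.
pose m := marker (size a + size b).
have sd := @summable_delta R.
apply: (@invertible_of_compress f ([::], a ++ m) (b ++ m, [::]) c'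
  (cv (cv (delta R ([::], a ++ m)) f2) (delta R (b ++ m, [::]))) (`|c| / 2 / 2)) => //; last first.
  rewrite -[X in bounded_by _ X]mulr1 -[X in bounded_by _ (X * _)]mul1r.
  by apply: bounded_by_cv (bounded_by_delta _ _); apply: bounded_by_cv (bounded_by_delta _ _) _.
have sf1 := summable_finite s f.
rewrite {1}fE cvDr // cvDl //; try exact: summable_cv.
rewrite (@compress_finite _ _ (fun p => `[< in_germ y x d e p >])) // => p ps.
have : (maxn (size p.1) (size p.2) <= Q)%N.
  by rewrite (leq_bigmax_seq (F := fun p : cu => maxn (size p.1) (size p.2))).
rewrite geq_max => /andP[h1 h2].
apply: compress_elt yE' xE' hs' _ _.
  by apply: leq_trans h1 _; rewrite /a size_cat size_mkseq leq_addl.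
by apply: leq_trans h2 _; rewrite /b size_cat size_mkseq leq_addl.
Qed.

(** * The zero-sum ideal and its maximality *)

Definition zero_sum_ideal f : Prop := inA f /\ zero_germ_sums f.

Lemma zero_sum_ideal_is_ideal : is_ideal zero_sum_ideal.
Proof.
split; first by move=> f [].
split.
- split; first by exists 0; apply/enum_boundedE; apply: bounded_by0.
  by move=> y x d e; rewrite -[RHS](sum0 R cu); apply: eq_sum => p; rewrite mul0r.
- move=> f g [/inAE hf zf] [/inAE hg zg]; split; first exact/inAE/summableD.
  move=> y x d e; rewrite -[RHS]addr0 -{1}(zf y x d e) -(zg y x d e) -sumD.
  + by apply: eq_sum => p; rewrite mulrDl.
  + exact: summable_germ.
  + exact: summable_germ.
- move=> c f [/inAE hf zf]; split; first exact/inAE/summableZ.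
  move=> y x d e; rewrite -[RHS](mulr0 c) -(zf y x d e) -sumZ; last exact: summable_germ.
  by apply: eq_sum => p; rewrite mulrA.
- move=> a f h /inAE ha [/inAE hf zf] /convE -> //.
  by split; [exact/inAE/summable_cv | exact: zero_germ_sums_cvl].
- move=> a f h /inAE ha [/inAE hf zf] /convE -> //.
  by split; [exact/inAE/summable_cv | exact: zero_germ_sums_cvr].
Qed.

(** A germ sum changes by at most the norm of the perturbation. *)
Lemma zero_sum_ideal_closed : is_closed zero_sum_ideal.
Proof.
move=> u f hu fA lim; split=> // y x d e; apply: norm_small0 => eps eps0.
have [N /(_ N (leqnn _)) /enum_boundedE hN] := lim eps eps0.
have [/inAE sN zN] := hu N; move/inAE: (fA) => sf.
have -> : `|usum (fun p => f p * germ_ind R y x d e p)| =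
    `|usum (fun p => (u N p - f p) * germ_ind R y x d e p)|.
  rewrite -normrN -sub0r -(zN y x d e) -mulN1r -sumZ; last exact: summable_germ.
  rewrite -sumD; [|exact: summable_germ | by apply: summableZ; apply: summable_germ].
  by congr `|_|; apply: eq_sum => p; rewrite mulrBl mulN1r.
apply: (has_sum_norm_le (a := fun p => (u N p - f p) * germ_ind R y x d e p)).
  apply: bounded_by_le hN => p.
  by rewrite [leLHS]normrM ler_piMr ?normr_ge0 ?germ_ind_le1.
by apply: has_sum_sum; apply: summable_germ; exists eps.
Qed.

Lemma inJ_zero_sum f : inJ f <-> zero_sum_ideal f.
Proof.
split=> [hJ|[/inAE hf zf]]; last exact: zero_germ_sums_inJ.
apply: hJ; [exact: zero_sum_ideal_is_ideal | exact: zero_sum_ideal_closed |].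
by split; [exact/inAE/summable_f0 | exact: zero_germ_sums_f0].
Qed.

Lemma zero_sum_ideal_unit : ~ zero_sum_ideal (delta_e R).
Proof.
(* The identity lies in the set of lag 0 at a constant pair of words, so the germ sum there is 1. *)
move=> [_ /(_ (fun=> false) (fun=> false) 0%N 0%N)].
rewrite /delta_e sum_delta /germ_ind asboolT; first by move=> /eqP; rewrite oner_eq0.
by exists (fun=> false); rewrite stream_cat_nil.
Qed.

Lemma ideal_invertible I f : is_ideal I -> I f -> two_sided_invertible f ->
  I (delta_e R).
Proof.
move=> [_ [_ _ _ Il Ir]] If [g [h [gf [gA hA]]]].
by move=> /(Il _ _ _ gA If) Igf /(Ir _ _ _ hA Igf).
Qed.

Lemma zero_sum_idealE f : inA f -> zero_sum_ideal f <-> ~ two_sided_invertible f.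
Proof.
move=> fA; split=> [zf inv|ninv].
  exact/zero_sum_ideal_unit/(ideal_invertible zero_sum_ideal_is_ideal zf).
split=> //; apply: contrapT => nz; apply: ninv; apply: invertible_of_germ_sum => //.
exact/inAE.
Qed.

(** An element outside the zero-sum ideal is two-sided invertible, so it would put [delta_e], and
    with it every [g] of the algebra, into [K]. *)
Lemma proper_ideal_sub (K : (cu -> C) -> Prop) f : Defs.proper_ideal K -> K f -> zero_sum_ideal f.
Proof.
move=> [Kid [g [gA ng]]] Kf; have [KA [_ _ _ _ Kr]] := Kid.
apply/(zero_sum_idealE (KA _ Kf)) => inv; apply: ng.
apply: (Kr g (delta_e R)) => //; first exact: ideal_invertible Kid Kf inv.
move/inAE: gA => sg; apply/convE => //; first exact: summable_delta.
by rewrite cv_el.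
Qed.

Lemma zero_sum_ideal_proper : Defs.proper_ideal zero_sum_ideal.
Proof.
split; first exact: zero_sum_ideal_is_ideal.
exists (delta_e R); split; last exact: zero_sum_ideal_unit.
exact/inAE/summable_delta.
Qed.

End Invertibility.

Theorem theorem3p15 (R : realType) :
  (forall f : cu -> R[i], inA f ->
     (inJ f <-> (forall v : cu, without_symmetric_core v -> zero_sums_at f v))
     /\ (inJ f <-> ~ two_sided_invertible f))
  /\ (forall f : cu -> R[i], inJ f <-> (inA f /\ ~ two_sided_invertible f))
  /\ (forall I : (cu -> R[i]) -> Prop,
        maximal_ideal I <-> (forall f, I f <-> inJ f)).
Proof.
split; [|split].
- move=> f fA; rewrite inJ_zero_sum; split; last exact: zero_sum_idealE.
  rewrite -zero_germ_sumsE; last exact/inAE.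
  by split=> [[]|].
- move=> f; rewrite inJ_zero_sum; split=> [zf|[fA ninv]]; last exact/zero_sum_idealE.
  by have [fA _] := zf; split=> //; apply/zero_sum_idealE.
- move=> I; split=> [[Ipr Imax] f|IJ].
    (* A maximal ideal lies in the zero-sum ideal, which is proper; maximality gives the other
       inclusion. *)
    rewrite inJ_zero_sum; split; first exact: proper_ideal_sub.
    by apply: Imax (@zero_sum_ideal_proper R) _ _ => g; apply: proper_ideal_sub.
  have -> : I = @zero_sum_ideal R.
    by apply/funext => f; apply/propext; rewrite IJ inJ_zero_sum.
  split; first exact: zero_sum_ideal_proper.
  by move=> K Kpr _ f; apply: proper_ideal_sub.
Qed.
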